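(* Let $p$ be a prime and let $v\in\mathbb{R}^p$ have pairwise distinct coordinates that do not sum to $0$. Let $C$ be the elementary symmetric curve associated to $v$ and $C_1$ an irreducible component of $C$. If $\mathrm{stab}(C_1)$ is not isomorphic to the dihedral group $D_{2p}$ of order $2p$, then $\max_H|H\cap S_pv|=(p-1)!$, where $H$ ranges over hyperplanes of $\mathbb{R}^p$ through the origin.
   Context: For $v=(c_1,\dots,c_n)$, the elementary symmetric curve associated to $v$ is the complex algebraic variety $C$ (in $\mathbb{C}^n$, viewed inside $\mathbb{P}^n_{\mathbb{C}}$) cut out by $e_k(x_1,\dots,x_n)=e_k(c_1,\dots,c_n)$ for $k=1,\dots,n-1$, where $e_k$ is the $k$-th elementary symmetric polynomial. $S_p$ acts on $\mathbb{C}^p$ by permuting coordinates, hence on the set of irreducible components of $C$; $\mathrm{stab}(C_1)$ is the stabilizer of $C_1$ under this action. $S_pv$ is the orbit of $v$. *)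

(* Defs.v *)
From HB Require Import structures.
From mathcomp Require Import all_boot all_order all_algebra all_fingroup all_solvable.
From mathcomp Require Import boolp classical_sets.
From mathcomp Require Import Rstruct complex.
From Stdlib Require Import Rdefinitions.

Set Implicit Arguments.
Unset Strict Implicit.
Unset Printing Implicit Defensive.

Import GRing.Theory.
Local Open Scope classical_set_scope.
Local Open Scope ring_scope.

Notation Rl := Rdefinitions.R.
Notation Cx := (complex Rdefinitions.R).

Definition esym (K : comNzRingType) (n k : nat) (x : 'I_n -> K) : K :=
  \sum_(A : {set 'I_n} | #|A| == k) \prod_(i in A) x i.

Inductive polyfun (K : comNzRingType) (n : nat) : (('I_n -> K) -> K) -> Prop :=
| pf_const (c : K) : polyfun (fun _ => c)
| pf_var (i : 'I_n) : polyfun (fun x => x i)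
| pf_add f g : polyfun f -> polyfun g -> polyfun (fun x => f x + g x)
| pf_mul f g : polyfun f -> polyfun g -> polyfun (fun x => f x * g x).

Definition zariski_closed (K : comNzRingType) (n : nat) (V : set ('I_n -> K)) :=
  exists S : set (('I_n -> K) -> K),
    (forall f, S f -> polyfun f) /\ (forall x, V x <-> (forall f, S f -> f x = 0)).

Definition irreducible_closed (K : comNzRingType) (n : nat) (V : set ('I_n -> K)) :=
  [/\ zariski_closed V, V !=set0 &
      forall A B : set ('I_n -> K), zariski_closed A -> zariski_closed B ->
        V `<=` A `|` B -> V `<=` A \/ V `<=` B].

Definition irreducible_component (K : comNzRingType) (n : nat)
    (C W : set ('I_n -> K)) :=
  [/\ irreducible_closed W, W `<=` C &
      forall W', irreducible_closed W' -> W `<=` W' -> W' `<=` C -> W' = W].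

Definition esym_curve (n : nat) (v : 'I_n -> Rl) : set ('I_n -> Cx) :=
  [set x | forall k : nat, (0 < k < n)%nat ->
             esym k x = esym k (fun i => Complex (v i) 0)].

Definition permact (T : Type) (n : nat) (s : 'S_n) (x : 'I_n -> T) : 'I_n -> T :=
  fun i => x (s i).

Definition stab (n : nat) (W : set ('I_n -> Cx)) : {set 'S_n} :=
  [set s : 'S_n | `[< permact s @` W = W >]].

Definition orbit_seq (n : nat) (v : 'I_n -> Rl) : seq {ffun 'I_n -> Rl} :=
  undup [seq [ffun i => permact s v i] | s <- enum 'S_n].

(* |H_a ∩ S_n v| where H_a = {x | sum_i a_i x_i = 0} (a hyperplane through
   the origin when a <> 0) *)
Definition hyp_orbit_count (n : nat) (a v : 'I_n -> Rl) : nat :=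
  count (fun w : {ffun 'I_n -> Rl} => \sum_i a i * w i == 0) (orbit_seq v).

(* Main.v *)
(* Write [f = prod_i (X - v_i)].  The points of the curve are the orderings of
   the roots of [f = z], [z] a complex number.  The product over all
   permutations [s] of the linear forms [sum_i a_i x_(s i)] is a polynomial in
   [z] of degree at most [(p-1)!], with a zero at [z = 0] for each [s] whose
   form vanishes at [v].  So a hyperplane with more than [(p-1)!] points of the
   orbit yields a linear relation with constant coefficients between the roots
   of [f = z], as power series at any point of the [z]-line.  The spaces of
   relations at two points differ by a permutation of the roots.
   At infinity the space is invariant under the [p]-cycle, hence cut out by
   Fourier conditions on [F_p], among them those at the frequencies [0] (because
   [sum_i v_i <> 0]) and [1]; by the argument of P. Mueller's proof of Burnside's
   theorem, a permutation preserving it is affine.  At a critical value the space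
   is invariant under the local monodromy, a product of transpositions since the
   critical points of [f] are simple; being affine, it fixes exactly one root.
   Hence [f - z = (X - al) A^2] for every critical value [z].  Two such equations
   form a Pell equation, which forces [f] to be a Chebyshev polynomial up to
   affine changes of variable, and then the components of the curve are rational
   curves with dihedral stabiliser. *)

Require Import Defs.
From Stdlib Require Import Rdefinitions.
From HB Require Import structures.
From mathcomp Require Import mpoly.
From mathcomp Require Import all_boot all_order all_algebra all_fingroup all_solvable.
From mathcomp Require Import all_field.
From mathcomp Require Import boolp classical_sets.
From mathcomp Require Import Rstruct complex.
From mathcomp Require Import ring zify.

Set Implicit Arguments.
Unset Strict Implicit.
Unset Printing Implicit Defensive.

Import Order.TTheory GRing.Theory Num.Theory.
Local Open Scope ring_scope.

(** * Permutations of F_p preserving a space of Fourier conditions *)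

(** The obstacle is to compare the roots at different points of the [z]-line without analytic
    continuation or Galois groups. The product of the permuted forms, called the norm, does this:
    its vanishing is a global fact, visible at every point, and at each point it makes some permuted
    form vanish. A priori the permutation depends on the form; one permutation serves all relations
    because a vector space is not a finite union of proper subspaces. Power series are replaced by
    polynomials modulo a power of ['X]. Nothing is lost, because in a local parameter the norm is a
    polynomial of bounded degree, so a sufficient finite precision decides whether it vanishes.
    Reality of [v] is what makes the critical points of [f] simple. Then [z + u^2] parametrises a
    neighbourhood of every critical value, and the substitution [u -> -u] supplies the involution
    that plays the role of the local monodromy. *)

Lemma poly_eq_on_Fp (p : nat) (P Q : {poly 'F_p}) : prime p ->
  (size P <= p)%N -> (size Q <= p)%N -> (forall x, P.[x] = Q.[x]) -> P = Q.
Proof.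
move=> pp sP sQ PQ; apply/eqP; rewrite -subr_eq0; apply/eqP.
apply: (@roots_geq_poly_eq0 _ _ (enum 'F_p)); last 2 first.
- exact: enum_uniq.
- rewrite -cardE card_Fp // (leq_trans (size_polyD _ _)) // size_polyN geq_max.
  by rewrite sP sQ.
by apply/allP => x _; rewrite rootE !hornerE PQ subrr.
Qed.

Lemma fun_poly_Fp (p : nat) (f : 'F_p -> 'F_p) : prime p ->
  exists2 F : {poly 'F_p}, (size F <= p)%N & forall x, F.[x] = f x.
Proof.
move=> pp; have p1 := prime_gt1 pp.
exists (\sum_a (f a *: (1 - ('X - a%:P) ^+ p.-1))).
  apply: (leq_trans (size_sum _ _ _)); apply/bigmax_leqP => a _.
  apply: (leq_trans (size_scale_leq _ _)); apply: (leq_trans (size_polyD _ _)).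
  by rewrite size_polyN size_polyC size_exp_XsubC geq_max; lia.
move=> x; rewrite horner_sum (bigD1 x) //= big1 ?addr0 => [|a ax].
  have p0 : (p.-1 == 0)%N = false by lia.
  by rewrite !hornerE subrr expr0n p0 subr0 mulr1.
rewrite !hornerE; suff -> : (x - a) ^+ p.-1 = 1 by rewrite subrr mulr0.
have xa0 : x - a != 0 by rewrite subr_eq0 eq_sym.
apply: (mulfI xa0); rewrite -exprS prednK ?prime_gt0 // mulr1.
by have := expf_card (x - a); rewrite card_Fp.
Qed.

(** With [r] the product of the [X - c] over the elements other than the head [a], the sum of
    [u * r(u)] over the whole list is [a * r(a)], which is nonzero; it is also a linear combination
    of the power sums of exponents 1 to the length of the list. *)
Lemma power_sum_neq0 (F : fieldType) (s : seq F) : uniq s -> 0 \notin s ->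
  s != [::] -> exists2 k, (0 < k <= size s)%N & \sum_(u <- s) u ^+ k != 0.
Proof.
case: s => // a s /= /andP[as_ us]; rewrite inE negb_or => /andP[a0 _] _.
case: (boolP [exists k : 'I_(size s).+1, \sum_(u <- a :: s) u ^+ k.+1 != 0]).
  by move=> /existsP[k hk]; exists k.+1 => //; have := ltn_ord k; lia.
rewrite negb_exists => /forallP H.
pose r := \prod_(c <- s) ('X - c%:P).
have : \sum_(u <- a :: s) u * r.[u] = 0.
  transitivity (\sum_(u <- a :: s) \sum_(i < (size s).+1) r`_i * u ^+ i.+1).
    apply: eq_bigr => u _; rewrite (@horner_coef_wide _ (size s).+1).
      by rewrite big_distrr /=; apply: eq_bigr => i _; rewrite exprS mulrCA.
    by rewrite size_prod_XsubC.
  rewrite exchange_big big1 //= => i _; rewrite -big_distrr /=.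
  by have := H i; rewrite negbK => /eqP ->; rewrite mulr0.
rewrite big_cons big_seq big1 ?addr0 => [/eqP|u us']; last first.
  have /rootP -> : root r u by rewrite root_prod_XsubC.
  by rewrite mulr0.
rewrite mulf_eq0 eq_sym (negbTE a0) /= => hr.
by move: as_; rewrite -root_prod_XsubC -/r rootE hr.
Qed.

(* Compare the coefficients of degree [n m - k] on both sides of
   [sum_(u in U) f(x + u)^m = sum_(u in U) (f(x) + u)^m], where [n] is the
   degree of [f] and [k] is least with a nonzero [k]-th power sum of [U]. *)
Lemma affine_of_difference_set (p : nat) (U : {set 'F_p}) (f : 'F_p -> 'F_p) :
  prime p -> injective f -> U != finset.set0 -> 0 \notin U -> (#|U| <= p.-1./2)%N ->
  (forall x, [set f (x + u) - f x | u in U] = U) ->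
  exists a b, forall x, f x = a * x + b.
Proof.
move=> pp finj U0 nU0 cU HU; have p1 := prime_gt1 pp.
have pch : p \in [pchar 'F_p] by apply: pchar_Fp.
pose S k := \sum_(u in U) u ^+ k.
have [k0 k0P k0min] : exists2 k0, [&& (0 < k0)%N, (k0 <= #|U|)%N & S k0 != 0]
    & forall k, (0 < k < k0)%N -> S k = 0.
  have ex : exists k, [&& (0 < k)%N, (k <= #|U|)%N & S k != 0].
    have [] := @power_sum_neq0 _ (enum U) (enum_uniq _).
    - by rewrite mem_enum.
    - by apply: contraNneq U0 => eU; rewrite -cards_eq0 cardE eU.
    move=> k; rewrite -cardE => /andP[k_gt0 kU]; rewrite big_enum /= => hS.
    by exists k; rewrite k_gt0 kU.
  exists (ex_minn ex); first by case: ex_minnP.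
  case: ex_minnP => k0 /and3P[h1 h2 h3] hmin k /andP[k1 k2].
  apply/eqP; apply/negPn/negP => hk; have := hmin k; rewrite k1 hk andbT /=.
  by move=> /(_ (ltnW (leq_trans k2 h2))); lia.
have {k0P} [k0gt k0U Sk0] := and3P k0P.
have [F sF hF] := fun_poly_Fp f pp.
case: (ltnP 2 (size F)) => sF2; last first.
  exists F`_1, F`_0 => x; rewrite -hF (@horner_coef_wide _ 2) //.
  by rewrite !big_ord_recr big_ord0 /= expr0 expr1 mulr1 add0r addrC.
(* [m] is the largest exponent with [n * m < p], so that [A] and [B] below are determined by their
   values on ['F_p]. As [n <= p - 1], also [p - 1 < 2 * n * m], whence
   [k0 <= #|U| <= (p - 1)/2 <= n * m]. *)
exfalso; pose n := (size F).-1; pose m := (p.-1 %/ n)%N.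
have n2 : (2 <= n)%N by rewrite /n; lia.
have np : (n <= p.-1)%N by rewrite /n; lia.
have m1 : (0 < m)%N by rewrite divn_gt0 //; lia.
have nmp : (n * m <= p.-1)%N by rewrite mulnC leq_divM.
have k0nm : (k0 <= n * m)%N.
  have : (p.-1 < n * m + n)%N.
    have n0 : (0 < n)%N by lia.
    by have := ltn_ceil p.-1 n0; rewrite -/m; lia.
  have : (n <= n * m)%N by rewrite leq_pmulr.
  lia.
have F0 : F != 0 by rewrite -size_poly_gt0; lia.
pose h := F ^+ m; pose D := (n * m)%N.
have sh : size h = D.+1.
  rewrite /h -(prednK (n := size (F ^+ m))) ?size_poly_gt0 ?expf_neq0 //.
  by rewrite size_exp.
pose A := \sum_(i < size h) (S i *: h^`N(i)).
pose B := \sum_(i < m.+1) ((S i *+ 'C(m, i)) *: F ^+ (m - i)).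
have sFi i : (size (F ^+ i) <= (n * i).+1)%N.
  by rewrite (leq_trans (size_poly_exp_leq _ _)).
have AB : A = B.
  apply: poly_eq_on_Fp => //.
  - apply: (leq_trans (size_sum _ _ _)); apply/bigmax_leqP => i _.
    apply: (leq_trans (size_scale_leq _ _)); apply/leq_sizeP => j pj.
    rewrite coef_nderivn nth_default ?mul0rn // [X in (X <= _)%N]sh.
    by have := leq_trans pj (leq_addl i j); rewrite /D; lia.
  - apply: (leq_trans (size_sum _ _ _)); apply/bigmax_leqP => i _.
    apply: (leq_trans (size_scale_leq _ _)); apply: (leq_trans (sFi _)).
    have : (n * (m - i) <= n * m)%N by rewrite leq_mul2l leq_subr orbT.
    lia.
  move=> x; transitivity (\sum_(u in U) h.[x + u]).
    rewrite horner_sum.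
    under [RHS]eq_bigr => u _ do rewrite (nderiv_taylor _ (mulrC _ _)).
    rewrite [RHS]exchange_big /=; apply: eq_bigr => i _.
    by rewrite hornerZ mulrC big_distrr.
  transitivity (\sum_(u in U) (f x + u) ^+ m).
    rewrite -[in RHS](HU x) big_imset /=; last first.
      by move=> u u' _ _ /addIr /finj /addrI.
    apply: eq_bigr => u _; rewrite /h horner_exp hF; congr (_ ^+ _).
    by rewrite [RHS]addrC subrK.
  rewrite horner_sum; under eq_bigr => u _ do rewrite exprDn.
  rewrite exchange_big /=; apply: eq_bigr => i _.
  rewrite hornerZ horner_exp hF /S -sumrMnl big_distrl /=.
  by apply: eq_bigr => u _; rewrite mulrC mulrnAl.
(* The terms [i = 0] agree. On the left only [i = k0] remains: smaller power sums vanish, and higher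
   derivatives have too small a degree. On the right [F ^+ (m - i)] with [i >= k0] has degree at
   most [D - n * i < D - k0], as [n >= 2]. So [S k0 * 'C(D, k0)] times the leading coefficient of
   [h] is zero, which [D < p] excludes. *)
have : A`_(D - k0) = B`_(D - k0) by rewrite AB.
rewrite /A /B !coef_sum sh big_ord_recl [in RHS]big_ord_recl /= !coefZ.
rewrite coef_nderivn bin0 subn0 add0n bin0 !mulr1n => /addrI.
have k0D : (k0.-1 < D)%N by rewrite /D; lia.
rewrite (bigD1 (Ordinal k0D)) //= !coefZ.
rewrite big1 => [|i ik]; last first.
  rewrite coefZ; case: (ltnP i.+1 k0) => [lt|ge].
    by rewrite k0min ?mul0r.
  rewrite coef_nderivn nth_default ?mul0rn ?mulr0 //.
  move: ik; rewrite -val_eqE /= sh => ik.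
  move: ik ge k0nm k0gt; rewrite /bump /= -/D => /eqP; lia.
rewrite [RHS]big1 => [|i _]; last first.
  rewrite coefZ; case: (ltnP i.+1 k0) => [lt|ge].
    by rewrite k0min ?mul0rn ?mul0r.
  rewrite nth_default ?mulr0 //; apply: (leq_trans (sFi _)).
  rewrite /bump /= add1n in ge *.
  have := ltn_ord i; rewrite /D; nia.
rewrite addr0 /bump /= add1n prednK // coef_nderivn addnC subnK //.
move=> /eqP; rewrite mulf_eq0 (negbTE Sk0) /= -mulr_natr mulf_eq0.
have -> : h`_D == 0 = false.
  have -> : D = (size h).-1 by rewrite sh.
  by rewrite -lead_coefE lead_coef_eq0 expf_eq0 (negbTE F0) andbF.
rewrite /= -(dvdn_pcharf pch) => pC.
have : (p %| D`!)%N by rewrite -(bin_fact k0nm) dvdn_mulr.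
have : (D < p)%N by rewrite /D; lia.
elim: (D) => [|d IH] dp; first by rewrite fact0 dvdn1; lia.
rewrite factS Euclid_dvdM // => /orP[/dvdn_leq|]; first by lia.
by apply: IH; lia.
Qed.

Section FourierFp.

Variables (C : numClosedFieldType) (p : nat) (z : C).
Hypotheses (pp : prime p) (zP : p.-primitive_root z).

Definition Fp_char (x : 'F_p) : C := z ^+ x.
Local Notation e := Fp_char.

Lemma Fp_char_nat n : e n%:R = z ^+ n.
Proof. by rewrite /e val_Fp_nat // (prim_expr_mod zP). Qed.

Lemma Fp_charD x y : e (x + y) = e x * e y.
Proof.
by rewrite -[x in LHS]natr_Zp -[y in LHS]natr_Zp -natrD Fp_char_nat exprD.
Qed.

Lemma Fp_char0 : e 0 = 1.
Proof. by rewrite /e expr0. Qed.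

Lemma Fp_char_eq1 x : (e x == 1) = (x == 0).
Proof.
rewrite /e -(prim_order_dvd zP) -val_eqE /=; apply/idP/eqP => [|->//].
have := ltn_ord x; rewrite [X in (_ < X)%N]Fp_cast // => xp.
by move=> /dvdn_leq; lia.
Qed.

Lemma Fp_char_conj x : (e x)^* = e (- x).
Proof.
have n1 : `|e x| = 1.
  apply/eqP; rewrite -(@pexpr_eq1 _ _ p) ?prime_gt0 ?normr_ge0 //.
  by rewrite -normrX /e -exprM mulnC exprM (prim_expr_order zP) expr1n normr1.
have e0 : e x != 0 by rewrite -normr_eq0 n1 oner_eq0.
apply: (mulfI e0); rewrite -normCK n1 expr1n -Fp_charD subrr Fp_char0 //.
Qed.

Lemma sum_Fp_char k : \sum_x e (x * k) = if k == 0 then p%:R else 0.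
Proof.
case: eqVneq => [->|k0].
  under eq_bigr => x _ do rewrite mulr0 Fp_char0.
  by rewrite sumr_const card_Fp.
have ek : e k - 1 != 0 by rewrite subr_eq0 Fp_char_eq1.
apply: (mulIf ek); rewrite mul0r mulrBr mulr1 mulr_suml.
apply/eqP; rewrite subr_eq0; apply/eqP.
rewrite [RHS](reindex_inj (addIr (1 : 'F_p))) /=; apply: eq_bigr => x _.
by rewrite mulrDl mul1r Fp_charD.
Qed.

Definition ord_Fp (x : 'F_p) : 'I_p := cast_ord (Fp_cast pp) x.

Lemma ord_FpK x : (ord_Fp x)%:R = x.
Proof. by rewrite /= natr_Zp. Qed.

Lemma Fp_ordK (i : 'I_p) : ord_Fp i%:R = i.
Proof. by apply: val_inj; rewrite /= val_Fp_nat // modn_small. Qed.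

Lemma sum_ord_Fp (G : 'F_p -> C) : \sum_(i < p) G i%:R = \sum_x G x.
Proof.
rewrite [RHS](reindex (fun i : 'I_p => i%:R)) //=.
by exists ord_Fp => x _; [apply: Fp_ordK | apply: ord_FpK].
Qed.

Definition fourier_vanish (K : pred 'F_p) (a : 'I_p -> C) :=
  forall k, K k -> \sum_i a i * e (i%:R * k) = 0.

(* The orthogonal projection onto [fourier_vanish K] is the circulant matrix
   with entries [q (j - i)]; it commutes with every permutation preserving that
   space, so the level sets of [q] are preserved by such a permutation. *)
Lemma perm_fourier_fix (K : pred 'F_p) (s : 'S_p) (a0 : 'I_p -> C) :
  K 0 -> K 1 -> fourier_vanish K a0 -> (exists i, a0 i != 0) ->
  (forall a, fourier_vanish K a -> fourier_vanish K (fun i => a (s i))) ->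
  (forall i, s (s i) = i) ->
  forall i j, i != j -> s i = i -> s j = j -> forall l, s l = l.
Proof.
move=> K0 K1 Va0 [i0 ai0] Vs ss.
have p0 : p%:R != 0 :> C by rewrite pnatr_eq0 -lt0n prime_gt0.
pose q (d : 'F_p) : C := p%:R^-1 * \sum_(k | ~~ K k) e (d * k).
pose P (i j : 'I_p) := q (j%:R - i%:R).
have PV j : fourier_vanish K (fun i => P i j).
  move=> k Kk; rewrite /P /q.
  under eq_bigr => i _ do rewrite -mulrA mulr_suml.
  rewrite -mulr_sumr exchange_big big1 ?mulr0 //= => l Kl.
  transitivity (\sum_(i < p) (e (j%:R * l) * e (i%:R * (k - l)))).
    by apply: eq_bigr => i _; rewrite -!Fp_charD; congr e; ring.
  rewrite -mulr_sumr (sum_ord_Fp (fun x => e (x * (k - l)))) sum_Fp_char.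
  rewrite subr_eq0; case: eqP => [kl|_]; last by rewrite mulr0.
  by rewrite -kl Kk in Kl.
have PK a : fourier_vanish K a -> forall i, \sum_j P i j * a j = a i.
  move=> Va i; rewrite /P /q.
  under eq_bigr => j _ do rewrite -mulrA mulr_suml.
  rewrite -mulr_sumr exchange_big /=.
  transitivity (p%:R^-1 * \sum_k \sum_(j < p) (e ((j%:R - i%:R) * k) * a j)).
    congr (_ * _); rewrite big_mkcond /=; apply: eq_bigr => k _.
    case: (boolP (K k)) => //= /Va Kk.
    transitivity (e (- i%:R * k) * \sum_j a j * e (j%:R * k)).
      by rewrite Kk mulr0.
    rewrite mulr_sumr; apply: eq_bigr => j _.
    by rewrite mulrCA mulrC -Fp_charD; congr (e _ * _); ring.
  rewrite exchange_big /= (bigD1 i) //= [X in _ + X]big1 ?addr0 => [|j ji].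
    rewrite -mulr_suml; under eq_bigr => k _ do rewrite subrr mul0r Fp_char0.
    by rewrite sumr_const card_Fp // mulrA mulVf // mul1r.
  rewrite -mulr_suml; under eq_bigr => k _ do rewrite mulrC.
  rewrite sum_Fp_char subr_eq0; case: eqP => [eji|]; last by rewrite mul0r.
  by case/eqP: ji; rewrite -(Fp_ordK i) -eji Fp_ordK.
have Pconj i j : (P i j)^* = P j i.
  rewrite /P /q rmorphM /= fmorphV rmorph_nat rmorph_sum /=; congr (_ * _).
  by apply: eq_bigr => k _; rewrite Fp_char_conj -mulNr opprB.
(* Write [P^s] for the matrix [P (s i) (s j)]. Invariance of the space under the involution [s]
   gives [P * P^s = P^s] and [P^s * P = P]; both matrices are Hermitian, so the adjoint of the
   second identity yields [P^s = P]. *)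
have PP' i j : \sum_l P i l * P (s l) (s j) = P (s i) (s j).
  by rewrite (PK (fun i => P (s i) (s j))) //; apply: Vs (PV _).
have P'P i j : \sum_l P (s i) (s l) * P l j = P i j.
  rewrite (reindex_inj (@perm_inj _ s)) /=.
  under eq_bigr => l _ do rewrite ss.
  by rewrite (PK (fun l => P (s l) j) (Vs _ (PV _))) ss.
have Ps i j : P (s i) (s j) = P i j.
  rewrite -PP' -[RHS]Pconj -P'P rmorph_sum /=; apply: eq_bigr => l _.
  by rewrite rmorphM /= !Pconj mulrC.
(* Otherwise [q] is constant off 0, and so is its Fourier transform, the indicator function of the
   complement of [K]. That transform vanishes at 1, hence at every nonzero frequency; with [K 0] the
   space is then zero, against [a0]. *)
have [d1 [d2 [d10 d20 qd]]] : exists d1 d2, [/\ d1 != 0, d2 != 0 & q d1 != q d2].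
  case: (boolP [exists d1, exists d2, [&& d1 != 0, d2 != 0 & q d1 != q d2]]).
    by move=> /existsP[d1 /existsP[d2 /and3P[]]]; exists d1, d2.
  rewrite negb_exists => /forallP H.
  have qc d : d != 0 -> q d = q 1.
    move=> d0; have := H d; rewrite negb_exists => /forallP/(_ 1).
    by rewrite d0 oner_eq0 /= negbK => /eqP.
  have qhat k : \sum_d q d * e (d * (- k)) = (~~ K k)%:R.
    rewrite /q; under eq_bigr => d _ do rewrite -mulrA mulr_suml.
    rewrite -mulr_sumr exchange_big /=.
    transitivity (p%:R^-1 * \sum_(l | ~~ K l) (if l == k then p%:R else 0) : C).
      congr (_ * _); apply: eq_bigr => l _; rewrite -subr_eq0 -sum_Fp_char.
      by apply: eq_bigr => d _; rewrite -Fp_charD; congr e; ring.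
    case: (boolP (K k)) => /= Kk.
      rewrite big1 ?mulr0 // => l Kl; case: eqP => // lk.
      by rewrite -lk (negbTE Kl) in Kk.
    rewrite (bigD1 k) //= eqxx big1 ?addr0 ?mulVf // => l /andP[_ /negbTE ->] //.
  have Kall k : K k.
    case: (eqVneq k 0) => [->//|k0].
    have val k' : k' != 0 -> \sum_d q d * e (d * (- k')) = q 0 - q 1.
      move=> k'0; rewrite (bigD1 0) //= mul0r Fp_char0 mulr1; congr (_ + _).
      transitivity (q 1 * \sum_(d | d != 0) e (d * (- k'))).
        by rewrite mulr_sumr; apply: eq_bigr => d d0; rewrite qc.
      have := sum_Fp_char (- k'); rewrite oppr_eq0 (negbTE k'0) (bigD1 0) //=.
      rewrite mul0r Fp_char0 => /eqP; rewrite addrC addr_eq0 => /eqP ->.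
      by rewrite mulrN1.
    apply/negPn/negP => nK; have := qhat k; rewrite val // nK /=.
    rewrite -(val 1) ?oner_eq0 // qhat K1 /= => /eqP.
    by rewrite eq_sym oner_eq0.
  move: ai0; rewrite -(PK a0 Va0) big1 ?eqxx // => j _.
  rewrite /P /q big_pred0 ?mulr0 ?mul0r // => k; by rewrite Kall.
pose f (x : 'F_p) : 'F_p := (s (ord_Fp x))%:R.
have finj : injective f.
  move=> x y /(congr1 ord_Fp); rewrite !Fp_ordK => /perm_inj/(congr1 val) /= xy.
  exact: val_inj.
have qf x y : q (f y - f x) = q (y - x).
  by rewrite -[y in RHS]ord_FpK -[x in RHS]ord_FpK; apply: Ps.
have faff : exists a b, forall x, f x = a * x + b.
  have Uf (Q : pred C) : let U := [set d : 'F_p | d != 0 & Q (q d)] in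
      forall x, [set f (x + u) - f x | u in U] = U.
    move=> U x; apply/eqP; rewrite eqEcard; apply/andP; split; last first.
      by rewrite card_imset // => u u' /addIr /finj /addrI.
    apply/fintype.subsetP => _ /imsetP[u uU ->]; move: uU; rewrite !inE => /andP[u0 qu].
    rewrite subr_eq0 (inj_eq finj) -subr_eq0 addrC addKr u0 /=.
    by rewrite qf addrC addKr.
  (* The two sets are nonempty by [d1] and [d2] and partition the nonzero elements, so one of them
     has at most [(p - 1)/2] elements, as [affine_of_difference_set] requires. *)
  pose U1 := [set d : 'F_p | d != 0 & q d == q d1].
  pose U2 := [set d : 'F_p | d != 0 & q d != q d1].
  have cU : (#|U1| + #|U2| = p.-1)%N.
    have := cardsC [set (0 : 'F_p)]; rewrite cards1 card_Fp // => cc.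
    rewrite -[in RHS]cc -(cardsID [set d | q d == q d1] (~: [set 0])).
    by rewrite add1n; congr (_ + _)%N; apply: eq_card => d; rewrite !inE 1?andbC.
  have half (m n : nat) : (m + n = p.-1 -> m <= n -> m <= p.-1./2)%N by lia.
  have [le|/ltnW le] := leqP #|U1| #|U2|.
    apply: (@affine_of_difference_set p U1) => //.
    - by apply/finset.set0Pn; exists d1; rewrite !inE d10 /=.
    - by rewrite !inE eqxx.
    - exact: half cU le.
    - exact: (Uf (fun c => c == q d1)).
  apply: (@affine_of_difference_set p U2) => //.
  - by apply/finset.set0Pn; exists d2; rewrite !inE d20 eq_sym qd.
  - by rewrite !inE eqxx.
  - by apply: half le; rewrite addnC.
  - exact: (Uf (fun c => c != q d1)).
have {faff} [a [b fab]] := faff.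
move=> i j ij si sj l.
have fi : f i%:R = i%:R by rewrite /f Fp_ordK si.
have fj : f j%:R = j%:R by rewrite /f Fp_ordK sj.
have ij0 : (i%:R : 'F_p) - j%:R != 0.
  rewrite subr_eq0; apply: contra_neq ij => eij.
  by rewrite -(Fp_ordK i) eij Fp_ordK.
have a1 : a = 1.
  apply: (mulIf ij0); rewrite mul1r -[in RHS]fi -[in RHS]fj !fab; ring.
have b0 : b = 0.
  by apply: (@addrI _ (i%:R)); rewrite addr0 -[RHS]fi fab a1 mul1r.
have : f l%:R = l%:R by rewrite fab a1 b0 mul1r addr0.
by rewrite /f Fp_ordK => /(congr1 ord_Fp); rewrite !Fp_ordK.
Qed.

End FourierFp.

(** * Norms of linear forms *)

Definition norm_form (A : comNzRingType) (n : nat) (a y : 'I_n -> A) : A :=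
  \prod_(s : 'S_n) \sum_i a i * y (s i).

(** [T] lists the terms of a polynomial in the elementary symmetric functions: a coefficient and, at
    index [k], the exponent of [e_(k+1)]. For [F] monic of degree [n], [(-1)^(k+1) F_(n-k-1)] is
    [e_(k+1)] of its roots; going through [F] allows evaluation where roots are known only
    approximately. *)
Definition coef_form (C A : comNzRingType) (n : nat) (h : C -> A)
    (T : seq (C * {ffun 'I_n -> nat})) (F : {poly A}) : A :=
  \sum_(t <- T) h t.1 * \prod_(k < n) ((-1) ^+ k.+1 * F`_(n - k.+1)) ^+ t.2 k.

Lemma msize_prod_linear (C : fieldType) n (I : Type) (r : seq I)
    (L : I -> {mpoly C[n]}) :
  (forall i, msize (L i) <= 2)%N -> (msize (\prod_(i <- r) L i)%R <= (size r).+1)%N.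
Proof.
move=> L2; elim: r => [|i r IH]; first by rewrite big_nil msize1.
rewrite big_cons; have [->|L0] := eqVneq (L i) 0; first by rewrite mul0r msize0.
have [->|Q0] := eqVneq (\prod_(j <- r) L j) 0; first by rewrite mulr0 msize0.
by rewrite msizeM //=; have := leq_add (L2 i) IH; move: (msize (L i) + _)%N; lia.
Qed.

(** The norm is symmetric of degree at most [n!] in [y], hence a polynomial of weight at most [n!]
    in the elementary symmetric functions. [T] depends on [a] alone, so one formula serves scalars
    and truncated power series. *)
Lemma norm_form_coef (C : fieldType) (n : nat) (a : 'I_n -> C) :
  exists2 T : seq (C * {ffun 'I_n -> nat}),
    forall t, t \in T -> (\sum_(k < n) t.2 k * k.+1 <= n`!)%N &
    forall (A : idomainType) (h : {rmorphism C -> A}) (y : 'I_n -> A),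
      norm_form (fun i => h (a i)) y = coef_form h T (\prod_i ('X - (y i)%:P)).
Proof.
pose Q : {mpoly C[n]} := \prod_(s : 'S_n) \sum_i a i *: 'X_(s i).
have Qsym : Q \is mpoly.symmetric.
  apply/issymP => t; rewrite /Q rmorph_prod /=.
  rewrite [RHS](reindex_inj (mulIg t)) /=; apply: eq_bigr => s _.
  rewrite raddf_sum /=; apply: eq_bigr => i _.
  by rewrite msymZ permM; congr (_ *: _); rewrite /msym mmapX mmap1U.
have sQ : (msize Q <= n`!.+1)%N.
  rewrite -card_Sn cardE /Q -big_enum /=.
  apply: msize_prod_linear => s; apply: (leq_trans (mmeasure_sum _ _ _ _)).
  apply/bigmax_leqP_seq => i _ _; apply: (leq_trans (mmeasureZ_le _ _ _)).
  by rewrite msizeX mdeg1.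
have [R [RQ wR]] := sym_fundamental Qsym.
exists [seq (R@_m, [ffun k : 'I_n => m k]) | m <- msupp R].
  move=> t /mapP[m mR ->] /=.
  have := leq_trans (mmeasure_mnm_lt _ mR) (leq_trans wR sQ).
  by rewrite ltnS; under eq_bigr => k _ do rewrite ffunE.
move=> A h y; transitivity (mmap h y Q).
  rewrite /Q rmorph_prod /=; apply: eq_bigr => s _.
  rewrite raddf_sum /=; apply: eq_bigr => i _.
  by rewrite mmapZ mmapX mmap1U.
rewrite -RQ /comp_mpoly [X in mmap _ _ X]/mmap raddf_sum /coef_form [RHS]big_map /=.
apply: eq_bigr => m _; rewrite rmorphM /= mmapC; congr (_ * _).
rewrite /mmap1 rmorph_prod /=; apply: eq_bigr => k _.
rewrite rmorphXn /= tnth_mktuple ffunE; congr (_ ^+ _).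
have kn : (k.+1 < n.+1)%N by rewrite ltnS.
have -> : \prod_i ('X - (y i)%:P) = \prod_(c <- [tuple y i | i < n]) ('X - c%:P).
  by rewrite big_tuple; apply: eq_bigr => i _; rewrite tnth_mktuple.
rewrite (mroots_coeff _ (Ordinal kn)) /= mulrA -exprMn mulrN1 opprK expr1n mul1r.
rewrite /mesym !raddf_sum /=; apply: eq_bigr => B _.
rewrite !rmorph_prod /=; apply: eq_bigr => i _.
by rewrite mmapX mmap1U mevalXU tnth_mktuple.
Qed.

(** * Congruences modulo X^N *)

Section ModXn.

Variable C : fieldType.
Implicit Types (p q : {poly C}) (N : nat).

Definition eq_modX N p q := 'X^N %| p - q.

Lemma eq_modXx N p : eq_modX N p p.
Proof. by rewrite /eq_modX subrr dvdp0. Qed.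

Lemma eq_modX_sym N p q : eq_modX N p q = eq_modX N q p.
Proof. by rewrite /eq_modX -opprB dvdpNr. Qed.

Lemma eq_modX0 N p : eq_modX N p 0 = ('X^N %| p).
Proof. by rewrite /eq_modX subr0. Qed.

Lemma eq_modX_trans N q p r : eq_modX N p q -> eq_modX N q r -> eq_modX N p r.
Proof. by rewrite /eq_modX => pq qr; rewrite -(subrKA q) dvdp_add. Qed.

Lemma eq_modXD N p p' q q' :
  eq_modX N p p' -> eq_modX N q q' -> eq_modX N (p + q) (p' + q').
Proof. by rewrite /eq_modX => hp hq; rewrite opprD addrACA dvdp_add. Qed.

Lemma eq_modXM N p p' q q' :
  eq_modX N p p' -> eq_modX N q q' -> eq_modX N (p * q) (p' * q').
Proof.
rewrite /eq_modX => hp hq.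
have -> : p * q - p' * q' = (p - p') * q + p' * (q - q') by ring.
by apply: dvdp_add; [apply: dvdp_mulr | apply: dvdp_mull].
Qed.

Lemma eq_modXX N p q k : eq_modX N p q -> eq_modX N (p ^+ k) (q ^+ k).
Proof.
move=> pq; elim: k => [|k IH]; first by rewrite !expr0 eq_modXx.
by rewrite !exprS eq_modXM.
Qed.

Lemma eq_modX_sum N (I : Type) (r : seq I) (F G : I -> {poly C}) :
  (forall i, eq_modX N (F i) (G i)) ->
  eq_modX N (\sum_(i <- r) F i) (\sum_(i <- r) G i).
Proof.
move=> FG; elim: r => [|i r IH]; first by rewrite !big_nil eq_modXx.
by rewrite !big_cons eq_modXD.
Qed.

Lemma eq_modX_prod N (I : Type) (r : seq I) (F G : I -> {poly C}) :
  (forall i, eq_modX N (F i) (G i)) ->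
  eq_modX N (\prod_(i <- r) F i) (\prod_(i <- r) G i).
Proof.
move=> FG; elim: r => [|i r IH]; first by rewrite !big_nil eq_modXx.
by rewrite !big_cons eq_modXM.
Qed.

Lemma eq_modX_horner N (F : {poly {poly C}}) p q :
  eq_modX N p q -> eq_modX N F.[p] F.[q].
Proof.
move=> pq; rewrite !horner_coef; apply: eq_modX_sum => i.
by apply: eq_modXM; rewrite ?eq_modXx // eq_modXX.
Qed.

Lemma eq_modXW M N p q : (M <= N)%N -> eq_modX N p q -> eq_modX M p q.
Proof. by move=> MN; apply: dvdp_trans; rewrite dvdp_exp2l. Qed.

Lemma dvdX_horner0 p : ('X %| p) = (p.[0] == 0).
Proof. by rewrite -['X]subr0 dvdp_XsubCl rootE. Qed.

Lemma dvdXn_mup N p : p != 0 -> ('X^N %| p) = (N <= mup 0 p)%N.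
Proof. by move=> p0; rewrite mup_geq // subr0. Qed.

Lemma dvdXn_cancel N q d :
  'X^(N.+1) %| q * d -> ~~ ('X^2 %| d) -> 'X^N %| q.
Proof.
have [->|q0] := eqVneq q 0; first by rewrite dvdp0.
have [->|d0] := eqVneq d 0; first by rewrite dvdp0.
rewrite !dvdXn_mup ?mulf_neq0 // mupM //; lia.
Qed.

Lemma dvdXn_prod N (I : eqType) (r : seq I) (P : I -> {poly C}) :
  'X^((N * size r).+1) %| \prod_(i <- r) P i ->
  exists2 i, i \in r & 'X^(N.+1) %| P i.
Proof.
move=> H; case: (altP (@hasP _ (fun i => 'X^(N.+1) %| P i) r)) => // nh.
have {}nh i : i \in r -> ~~ ('X^(N.+1) %| P i).
  by move=> ir; apply/negP => h; move/hasP: nh; apply; exists i.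
suff [p0 pm] : \prod_(i <- r) P i != 0 /\ (mup 0 (\prod_(i <- r) P i) <= N * size r)%N.
  by move: H; rewrite dvdXn_mup //; lia.
elim: r {H} nh => [|i r IH] nh.
  by rewrite big_nil oner_eq0 mupNroot ?root1.
have [|r0 rm] := IH; first by move=> j jr; apply: nh; rewrite inE jr orbT.
have := nh i; rewrite inE eqxx => /(_ isT) hi; rewrite big_cons.
have i0 : P i != 0 by apply: contraNneq hi => ->; rewrite dvdp0.
split; first by rewrite mulf_neq0.
by move: hi; rewrite dvdXn_mup // -ltnNge ltnS mupM //= mulnS => hi; rewrite leq_add.
Qed.

Lemma horner_taylor2 (R : comNzRingType) (F : {poly R}) (y h : R) :
  exists r, F.[y + h] = F.[y] + F^`().[y] * h + h ^+ 2 * r.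
Proof.
exists (\sum_(i < size F) F^`N(i.+2).[y] * h ^+ i).
have sF : (size F <= (size F).+2)%N by rewrite ltnW.
rewrite (nderiv_taylor_wide (mulrC y h) sF).
rewrite big_ord_recl big_ord_recl /= expr0 expr1 mulr1 nderivn0 nderivn1 addrA.
congr (_ + _); rewrite mulr_sumr; apply: eq_bigr => i _.
by rewrite [RHS]mulrCA -exprD.
Qed.

Lemma hensel_modX (F : {poly {poly C}}) (t : C) :
  F.[t%:P].[0] = 0 -> F^`().[t%:P].[0] != 0 ->
  forall N, exists2 y : {poly C}, y.[0] = t & 'X^N %| F.[y].
Proof.
move=> F0 dF N.
suff [y yt yN] : exists2 y : {poly C}, y.[0] = t & 'X^(N.+1) %| F.[y].
  by exists y => //; apply: dvdp_trans yN; rewrite dvdp_exp2l.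
elim: N => [|N [y yt /dvdpP[q Fy]]].
  by exists t%:P; rewrite ?hornerC // expr1 dvdX_horner0 F0.
have dFy : F^`().[y].[0] != 0.
  suff : 'X %| F^`().[y] - F^`().[t%:P].
    by rewrite dvdX_horner0 hornerD hornerN subr_eq0 => /eqP ->.
  have := @eq_modX_horner 1 F^`() y t%:P; rewrite /eq_modX !expr1; apply.
  by rewrite dvdX_horner0 !hornerE yt subrr.
pose c := - q.[0] / F^`().[y].[0].
exists (y + c%:P * 'X^(N.+1)); first by rewrite !hornerE yt expr0n mulr0 addr0.
have [r ->] := horner_taylor2 F y (c%:P * 'X^(N.+1)).
rewrite Fy dvdp_add //; last first.
  by rewrite dvdp_mulr // exprMn -exprM dvdp_mull // dvdp_exp2l //; lia.
have -> : q * 'X^(N.+1) + F^`().[y] * (c%:P * 'X^(N.+1)) =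
  'X^(N.+1) * (q + F^`().[y] * c%:P) by ring.
rewrite exprSr dvdp_mul // dvdX_horner0 hornerD hornerM hornerC /c.
by rewrite mulrCA mulfV // mulr1 subrr.
Qed.

(** After the factor of [y] is split off, the values of the quotient at the other points are divided
    by [y' - y], which costs at most one power of ['X] by the separation hypothesis; hence the
    reserve of [size ys] powers. *)
Lemma dvdXn_coef_of_roots (ys : seq {poly C}) (D : {poly {poly C}}) N :
  (size D <= size ys)%N -> pairwise (fun y y' => ~~ ('X^2 %| y - y')) ys ->
  (forall y, y \in ys -> 'X^(N + size ys) %| D.[y]) ->
  forall k, 'X^N %| D`_k.
Proof.
elim: ys D N => [|y ys IH] D N /= sD.
  by move=> _ _ k; move: sD; rewrite leqn0 size_poly_eq0 => /eqP ->; rewrite coef0 dvdp0.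
move=> /andP[yys pys] HD k.
have rt : root (D - D.[y]%:P) y by rewrite rootE !hornerE subrr.
have [Q DQ] : exists Q : {poly {poly C}}, D - D.[y]%:P = Q * ('X - y%:P) by apply/factor_theorem.
have Dy : 'X^(N + (size ys).+1) %| D.[y] by apply: HD; rewrite inE eqxx.
have DE : D = Q * ('X - y%:P) + D.[y]%:P by rewrite -DQ subrK.
have sQ : (size Q <= size ys)%N.
  have [->|Q0] := eqVneq Q 0; first by rewrite size_poly0.
  suff : (size (Q * ('X - y%:P))%R <= (size ys).+1)%N.
    by rewrite size_Mmonic ?monicXsubC // size_XsubC addn2.
  rewrite -DQ (leq_trans (size_polyD _ _)) // size_polyN geq_max sD.
  by rewrite size_polyC; case: (_ == _).
have QN : forall k, 'X^N %| Q`_k.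
  apply: IH => // y' y's; apply: (@dvdXn_cancel _ _ (y' - y)); last first.
    by rewrite -opprB dvdpNr; move/allP: yys; apply.
  rewrite -addnS; have -> : Q.[y'] * (y' - y) = D.[y'] - D.[y].
    by rewrite [in D.[y']]DE !hornerE addrK.
  by rewrite dvdp_sub // HD // inE y's orbT.
have Dy' : 'X^N %| D.[y] by apply: dvdp_trans Dy; rewrite dvdp_exp2l ?leq_addr.
rewrite DE mulrBr coefD coefB coefMX coefMC coefC dvdp_add ?dvdp_sub //.
- by case: ifP => // _; rewrite dvdp0.
- by rewrite dvdp_mulr.
- by case: ifP => // _; rewrite dvdp0.
Qed.

End ModXn.

(** * Relations between the roots of f = z *)

Lemma poly_infinite_roots (C : numFieldType) (P : {poly C}) :
  (forall u, u != 0 -> P.[u] = 0) -> P = 0.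
Proof.
move=> P0; pose rs : seq C := [seq i.+1%:R | i <- iota 0 (size P)].
apply: (@roots_geq_poly_eq0 _ P rs); last by rewrite size_map size_iota.
  by apply/allP => _ /mapP[i _ ->]; rewrite rootE P0 // pnatr_eq0.
rewrite map_inj_uniq ?iota_uniq // => i j /eqP.
by rewrite eqr_nat eqSS => /eqP.
Qed.

(* A vector space over an infinite field is not a finite union of proper
   subspaces. *)
Lemma subspace_cover (C : numFieldType) (I : Type) (T : finType)
    (A : (I -> C) -> Prop) (B : T -> (I -> C) -> Prop) (a0 : I -> C) :
  A a0 ->
  (forall a b t, A a -> A b -> A (fun i => a i + t * b i)) ->
  (forall s a b t, B s a -> B s b -> B s (fun i => a i + t * b i)) ->
  (forall s a t, B s a -> B s (fun i => t * a i)) ->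
  (forall a, A a -> exists s, B s a) ->
  exists s, forall a, A a -> B s a.
Proof.
move=> Aa0 AL BL BZ AB; apply: contrapT => /forallNP nAB.
have {}nAB s : exists a, A a /\ ~ B s a.
  by have /existsNP[a /not_implyP[Aa nB]] := nAB s; exists a.
suff [a [Aa nBa]] : exists a, A a /\ forall s, s \in enum T -> ~ B s a.
  by have [s Bs] := AB a Aa; apply: (nBa s) => //; rewrite mem_enum.
elim: (enum T) => [|s l [a [Aa nBa]]]; first by exists a0.
have [Bsa|nBsa] := pselect (B s a); last first.
  by exists a; split => // s'; rewrite inE => /predU1P[->|/nBa].
have [b [Ab nBb]] := nAB s.
(* A subspace with two points on the line [a + k b] contains [a] and [b]. One that misses [a]
   therefore meets the line at most once, and all large [k] avoid every subspace of the list [l]. *)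
have Bdiff s' (k k' : nat) : k != k' ->
    B s' (fun i => a i + k%:R * b i) -> B s' (fun i => a i + k'%:R * b i) ->
    B s' b /\ B s' a.
  move=> kk' Bk Bk'.
  have k0 : k%:R - k'%:R != 0 :> C by rewrite subr_eq0 eqr_nat.
  have Bb : B s' b.
    have := BZ s' _ (k%:R - k'%:R)^-1 (BL s' _ _ (-1) Bk Bk').
    by congr (B s' _); apply/funext => i; field.
  split=> //; have := BL s' _ _ (- k%:R) Bk Bb.
  by congr (B s' _); apply/funext => i; ring.
have [m Hm] : exists m, forall k, (m <= k)%N -> forall s', s' \in l ->
    ~ B s' (fun i => a i + k%:R * b i).
  elim: l nBa => [|s' l IH] nBa; first by exists 0%N.
  have [|m Hm] := IH; first by move=> u ul; apply: nBa; rewrite inE ul orbT.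
  have [[k0 Bk0]|nk] := pselect (exists k, B s' (fun i => a i + k%:R * b i)).
    exists (maxn m k0.+1) => k; rewrite geq_max => /andP[mk k0k] u.
    rewrite inE => /predU1P[->|ul]; last exact: Hm.
    have kk : k0 != k by rewrite neq_ltn k0k.
    move=> Bk; have [_] := Bdiff s' _ _ kk Bk0 Bk.
    by apply: nBa; rewrite inE eqxx.
  exists m => k mk u; rewrite inE => /predU1P[->|ul]; last exact: Hm.
  by move=> Bk; apply: nk; exists k.
exists (fun i => a i + m.+1%:R * b i); split; first exact: AL.
move=> u; rewrite inE => /predU1P[->|]; last by apply: Hm.
move=> Bm; have [|//] := Bdiff s 0%N m.+1 isT _ Bm.
by have := BL s a a 0 Bsa Bsa; congr (B s _); apply/funext => i; ring.
Qed.

(** * Fibres of f and the norm on them *)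

Section NormOnFibers.

Variables (C : numClosedFieldType) (n : nat).
Implicit Types (a : 'I_n -> C) (f : {poly C}).

Definition fiber f (z : C) (x : 'I_n -> C) :=
  \prod_i ('X - (x i)%:P) = f - z%:P.

(** The norm does not depend on the order of the roots and is a polynomial in [z]; the condition
    says that this polynomial is zero. *)
Definition vanishing_norm f a := forall z x, fiber f z x -> norm_form a x = 0.

Lemma fiber_exists f z : (0 < n)%N -> f \is monic -> size f = n.+1 ->
  exists x, fiber f z x.
Proof.
move=> n0 fm sf; have [r fr] := closed_field_poly_normal (f - z%:P).
have sfz : size (f - z%:P) = n.+1.
  by rewrite size_polyDl // sf size_polyN size_polyC; case: (_ == _).
have fzm : lead_coef (f - z%:P) = 1.
  rewrite lead_coefDl; first exact: (eqP fm).
  by rewrite sf size_polyN size_polyC; case: (_ == _).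
have sr : size r = n.
  by move: sfz; rewrite fr fzm scale1r size_prod_XsubC => -[].
exists (fun i => r`_i); rewrite /fiber fr fzm scale1r.
by rewrite (big_nth 0) sr big_mkord.
Qed.

Lemma norm_form_perm (A : comNzRingType) (a y : 'I_n -> A) (s : 'S_n) :
  norm_form (fun i => a (s i)) y = norm_form a y.
Proof.
rewrite /norm_form [RHS](reindex_inj (mulgI (s^-1)%g)) /=.
apply: eq_bigr => t _; rewrite [RHS](reindex_inj (@perm_inj _ s)) /=.
by apply: eq_bigr => i _; rewrite permM permK.
Qed.

Lemma norm_formZ (A : comNzRingType) (a y : 'I_n -> A) (c : A) :
  norm_form a (fun i => c * y i) = c ^+ n`! * norm_form a y.
Proof.
rewrite /norm_form -card_Sn -prodr_const; under [X in X * _]eq_bigl do rewrite inE.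
rewrite -big_split /=; apply: eq_bigr => s _; rewrite mulr_sumr.
by apply: eq_bigr => i _; rewrite mulrCA.
Qed.

Section CoefForm.

Variables (T : seq (C * {ffun 'I_n -> nat})).

Lemma coef_form_horner (F : {poly {poly C}}) c :
  (coef_form (@polyC C) T F).[c] = coef_form idfun T (map_poly (horner_eval c) F).
Proof.
rewrite /coef_form horner_sum; apply: eq_bigr => t _.
rewrite hornerM hornerC horner_prod; congr (_ * _); apply: eq_bigr => k _.
rewrite horner_exp hornerM coef_map /= /horner_eval; congr ((_ * _) ^+ _).
by rewrite horner_exp !hornerE.
Qed.

Lemma coef_form_eq_modX N (F G : {poly {poly C}}) :
  (forall k, (k < n)%N -> eq_modX N F`_k G`_k) ->
  eq_modX N (coef_form (@polyC C) T F) (coef_form (@polyC C) T G).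
Proof.
move=> FG; apply: eq_modX_sum => t; apply: eq_modXM; first exact: eq_modXx.
apply: eq_modX_prod => k; apply: eq_modXX; apply: eq_modXM; first exact: eq_modXx.
by apply: FG; rewrite -subn_gt0 subKn //; apply: ltn_ord.
Qed.

Lemma size_coef_form_bound (d : 'I_n -> nat) D (F : {poly {poly C}}) :
  (forall k : 'I_n, (size (F`_(n - k.+1)%N)%R <= (d k).+1)%N) ->
  (forall t, t \in T -> \sum_(k < n) t.2 k * d k <= D)%N ->
  (size (coef_form (@polyC C) T F) <= D.+1)%N.
Proof.
move=> sF dD; rewrite /coef_form big_seq_cond.
apply: (leq_trans (size_sum _ _ _)); apply/bigmax_leqP_seq => t tT _.
rewrite mul_polyC (leq_trans (size_scale_leq _ _)) //.
apply: leq_trans (_ : (\sum_(k < n) t.2 k * d k).+1 <= _)%N; last by rewrite ltnS dD.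
elim/big_rec2: _ => [|k m P _ IH]; first by rewrite size_poly1.
apply: (leq_trans (size_polyMleq _ _)).
have : (size (((-1) ^+ k.+1 * F`_(n - k.+1)) ^+ t.2 k)%R <= (t.2 k * d k).+1)%N.
  apply: (leq_trans (size_poly_exp_leq _ _)); rewrite ltnS mulnC leq_mul //.
  rewrite -signr_odd; have := sF k.
  by case: odd; rewrite ?expr1 ?expr0 ?mul1r ?mulN1r ?size_polyN; case: (size _).
move: (size _) IH => u; move: (size _) => w; lia.
Qed.

End CoefForm.

End NormOnFibers.

(** * Relations between branches, compared from place to place *)

Section Places.

Variables (C : numClosedFieldType) (n : nat) (f : {poly C}).
Hypotheses (n_gt0 : (0 < n)%N) (fm : f \is monic) (sf : size f = n.+1).
Implicit Types (a : 'I_n -> C) (F : {poly {poly C}}) (y : 'I_n -> {poly C}).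

Definition lin_rel M (a : 'I_n -> C) (y : 'I_n -> {poly C}) :=
  'X^M %| \sum_i (a i)%:P * y i.

(* [y] lists, to precision ['X^N], the roots of the one-parameter polynomial
   [F], whose specialisations are the rescaled fibers of [f]. *)
Definition place N F (y : 'I_n -> {poly C}) :=
  [/\ forall k : 'I_n, (size (F`_(n - k.+1)%N)%R <= k.+2)%N,
      forall k, (k < n)%N -> eq_modX N (\prod_i ('X - (y i)%:P))`_k F`_k,
      forall u, u != 0 -> exists z x c, fiber f z x /\
        map_poly (horner_eval u) F = \prod_(i < n) ('X - (c * x i)%:P)
    & forall z x, z != 0 -> fiber f z x -> exists u c, c != 0 /\
        map_poly (horner_eval u) F = \prod_(i < n) ('X - (c * x i)%:P)].

Definition norm_expansion (T : seq (C * {ffun 'I_n -> nat})) (a : 'I_n -> C) :=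
  forall (A : idomainType) (h : {rmorphism C -> A}) (y : 'I_n -> A),
    norm_form (fun i => h (a i)) y = coef_form h T (\prod_i ('X - (y i)%:P)).

Definition generic_fiber (g : {poly C}) : {poly {poly C}} := f^:P - g%:P.

Lemma generic_fiber_horner g u :
  map_poly (horner_eval u) (generic_fiber g) = f - (g.[u])%:P.
Proof.
rewrite /generic_fiber rmorphB /= map_polyC /= -map_poly_comp /=.
by rewrite map_poly_id // => c _; rewrite /= /horner_eval hornerC.
Qed.

(** The norm is a polynomial in [z], so one value may be left out. The place at infinity needs this:
    its parameter, with [z u^n = 1], never reaches [z = 0]. *)
Lemma vanishing_norm_nonzero T a :
  norm_expansion T a ->
  (forall z x, z != 0 -> fiber f z x -> norm_form a x = 0) -> vanishing_norm f a.
Proof.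
move=> HT H; pose P := coef_form (@polyC C) T (generic_fiber 'X).
have PE z x : fiber f z x -> norm_form a x = P.[z].
  move=> fx; rewrite coef_form_horner generic_fiber_horner hornerX.
  by rewrite (HT C idfun) fx.
have P0 : P = 0.
  apply: poly_infinite_roots => u u0.
  by have [x fx] := fiber_exists u n_gt0 fm sf; rewrite -(PE u x) // (H u).
by move=> z x fx; rewrite (PE z) // P0 horner0.
Qed.

Lemma place_vanishing N F y T a : place N F y ->
  norm_expansion T a ->
  (vanishing_norm f a <-> coef_form (@polyC C) T F = 0).
Proof.
move=> [_ _ h3 h4] HT.
have HE u (c : C) (x : 'I_n -> C) :
    map_poly (horner_eval u) F = \prod_(i < n) ('X - (c * x i)%:P) ->
    (coef_form (@polyC C) T F).[u] = c ^+ n`! * norm_form a x.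
  by move=> Fu; rewrite coef_form_horner Fu -norm_formZ (HT C idfun).
split=> [Wa|R0].
  apply: poly_infinite_roots => u u0; have [z [x [c [fx Fu]]]] := h3 u u0.
  by rewrite (HE u c x) // (Wa z) // mulr0.
apply: (vanishing_norm_nonzero HT) => z x z0 fx.
have [u [c [c0 Fu]]] := h4 z x z0 fx.
have /eqP := HE u c x Fu; rewrite R0 horner0 eq_sym mulf_eq0 expf_eq0.
by rewrite (negbTE c0) andbF => /eqP.
Qed.

Lemma coef_form_place N F y T a : place N F y ->
  norm_expansion T a ->
  eq_modX N (\prod_(s : 'S_n) \sum_i (a i)%:P * y (s i)) (coef_form (@polyC C) T F).
Proof.
move=> [_ h2 _ _] HT; have := HT {poly C} (@polyC C) y; rewrite /norm_form /= => ->.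
exact: coef_form_eq_modX.
Qed.

(** Of [n!] factors whose product is divisible by ['X^(M n! + 1)], one is divisible by
    ['X^(M + 1)]. *)
Lemma vanishing_norm_rel N M F y a : place N F y -> ((M * n`!).+1 <= N)%N ->
  vanishing_norm f a -> exists s : 'S_n, lin_rel M.+1 (fun i => a (s i)) y.
Proof.
move=> hp MN Wa; have [T wT HT] := norm_form_coef a.
have := coef_form_place hp HT; rewrite (place_vanishing hp HT).1 // eq_modX0.
move=> /(dvdp_trans (dvdp_exp2l 'X MN)) hdiv.
have [|s _ hs] := @dvdXn_prod C M _ (enum 'S_n)
    (fun s : 'S_n => \sum_i (a i)%:P * y (s i)).
  by rewrite -cardE card_Sn big_enum.
exists (s^-1)%g; rewrite /lin_rel (reindex_inj (@perm_inj _ s)) /=.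
by under eq_bigr do rewrite permK.
Qed.

(** In the parameter of the place the norm is a polynomial of degree at most [n!]; a relation to
    precision [n! + 1] makes it divisible by ['X^(n! + 1)], so it is zero. *)
Lemma rel_vanishing_norm N F y a : place N F y -> (n`!.+1 <= N)%N ->
  lin_rel n`!.+1 a y -> vanishing_norm f a.
Proof.
move=> hp MN ya; have [T wT HT] := norm_form_coef a.
apply/(place_vanishing hp HT); apply/eqP; apply/negPn/negP => R0.
have [h1 _ _ _] := hp.
have hdiv : 'X^(n`!.+1) %| coef_form (@polyC C) T F.
  rewrite -eq_modX0.
  apply: (@eq_modX_trans _ _ (\prod_(s : 'S_n) \sum_i (a i)%:P * y (s i))).
    by rewrite eq_modX_sym; apply: eq_modXW MN (coef_form_place hp HT).
  rewrite eq_modX0 (bigD1 1%g) //=; under eq_bigr do rewrite perm1.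
  exact: dvdp_mulr.
have := dvdp_leq R0 hdiv; rewrite size_polyXn.
have := size_coef_form_bound (d := fun k => k.+1) (D := n`!) h1 wT.
by move=> h /leq_trans /(_ h); rewrite ltnn.
Qed.

(** A relation at the first place kills the norm, hence is, after some permutation, a relation at
    the second. [subspace_cover] makes the permutation the same for all relations. *)
Lemma place_sub N M F y F' y' : place N F y -> place N F' y' ->
  (n`! <= M)%N -> ((M * n`!).+1 <= N)%N ->
  exists s : 'S_n, forall a, lin_rel M.+1 a y -> lin_rel M.+1 (fun i => a (s i)) y'.
Proof.
move=> hp hp' nM MN.
have fact1 := fact_gt0 n.
apply: (@subspace_cover C _ _ _
  (fun (s : 'S_n) a => lin_rel M.+1 (fun i => a (s i)) y') (fun=> 0)).
- by rewrite /lin_rel big1 ?dvdp0 // => i _; rewrite polyC0 mul0r.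
- move=> a b t ha hb; rewrite /lin_rel.
  under eq_bigr => i _ do rewrite polyCD polyCM mulrDl -mulrA.
  by rewrite big_split /= -mulr_sumr dvdp_add // dvdp_mull.
- move=> s a b t ha hb; rewrite /lin_rel.
  under eq_bigr => i _ do rewrite polyCD polyCM mulrDl -mulrA.
  by rewrite big_split /= -mulr_sumr dvdp_add // dvdp_mull.
- move=> s a t ha; rewrite /lin_rel.
  under eq_bigr => i _ do rewrite polyCM -mulrA.
  by rewrite -mulr_sumr dvdp_mull.
move=> a ya; apply: (vanishing_norm_rel hp' MN).
apply: (rel_vanishing_norm hp); first by nia.
by apply: dvdp_trans ya; rewrite dvdp_exp2l.
Qed.

(** Going to the other place and back maps the relations at [y] into themselves by [w = t * s]. The
    inverse of [w] is a power of [w], so the inclusion of [place_sub] can be reversed. *)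
Lemma place_conj N M F y F' y' : place N F y -> place N F' y' ->
  (n`! <= M)%N -> ((M * n`!).+1 <= N)%N ->
  exists s : 'S_n, forall a, lin_rel M.+1 a y <-> lin_rel M.+1 (fun i => a (s i)) y'.
Proof.
move=> hp hp' nM MN.
have [s hs] := place_sub hp hp' nM MN; have [t ht] := place_sub hp' hp nM MN.
exists s => a; split=> [|ya]; first exact: hs.
pose w := (t * s)%g.
have step b : lin_rel M.+1 b y -> lin_rel M.+1 (fun i => b (w i)) y.
  by move=> /hs /ht; congr (is_true (lin_rel _ _ _)); apply/funext => i; rewrite permM.
have {}ya : lin_rel M.+1 (fun i => a (w i)) y.
  by move/ht: ya; congr (is_true (lin_rel _ _ _)); apply/funext => i; rewrite permM.
have stepn k b : lin_rel M.+1 (fun i => b (w i)) y ->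
    lin_rel M.+1 (fun i => b ((w ^+ k.+1)%g i)) y.
  elim: k b => [|k IH] b hb; first by rewrite expg1.
  have := IH (fun i => b (w i)) (step _ hb); congr (is_true (lin_rel _ _ _)).
  by apply/funext => i; rewrite [in RHS]expgSr !permM.
have := stepn (#[w]%g).-1 a ya; rewrite prednK ?order_gt0 // expg_order.
by congr (is_true (lin_rel _ _ _)); apply/funext => i; rewrite perm1.
Qed.

(** The difference of the two monic polynomials has degree below [n] and is small at the [n]
    elements [y i]. Branches may share their constant term as long as they differ at order one,
    which is what happens over a critical value. *)
Lemma eq_modX_factor N F y : F \is monic -> size F = n.+1 ->
  (forall i j, i != j -> ~~ ('X^2 %| y i - y j)) ->
  (forall i, 'X^(N + n) %| F.[y i]) ->
  forall k, eq_modX N (\prod_i ('X - (y i)%:P))`_k F`_k.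
Proof.
move=> Fm sF yy Fy k; rewrite /eq_modX -coefB.
have inj_y : injective y.
  move=> i j yij; apply/eqP; apply/negPn/negP => /yy.
  by rewrite yij subrr dvdp0.
have Pm : \prod_i ('X - (y i)%:P) \is monic by rewrite -big_enum monic_prod_XsubC.
have sP : size (\prod_i ('X - (y i)%:P)) = n.+1.
  by rewrite -big_enum /= size_prod_XsubC size_enum_ord.
apply: (@dvdXn_coef_of_roots _ [seq y i | i <- enum 'I_n]).
- rewrite size_map size_enum_ord; apply/leq_sizeP => j; rewrite leq_eqVlt coefB.
  have := monicP Fm; have := monicP Pm; rewrite !lead_coefE sP sF /= => Pn Fn.
  move=> /predU1P[<-|nj]; first by rewrite Pn Fn subrr.
  by rewrite !nth_default ?subrr // ?sP ?sF.
- rewrite pairwise_map; have := enum_uniq 'I_n; rewrite uniq_pairwise.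
  by apply: sub_pairwise => i j; apply: yy.
- move=> _ /mapP[i _ ->]; rewrite size_map size_enum_ord.
  rewrite hornerD hornerN horner_prod (bigD1 i) //= !hornerE subrr mul0r.
  by rewrite sub0r dvdpNr.
Qed.

End Places.

Lemma dvdXn_coefP (C : fieldType) (p : {poly C}) N :
  reflect (forall m, (m < N)%N -> p`_m = 0) ('X^N %| p).
Proof.
apply: (iffP idP) => [/dvdpP[q ->] m mN|H]; first by rewrite coefMXn mN.
rewrite -[p](poly_take_drop N) (_ : take_poly N p = 0) ?add0r ?dvdp_mull //.
by apply/polyP => m; rewrite coef_take_poly coef0; case: ifP => // /H.
Qed.

Lemma poly_eq_horner (C : numFieldType) (P Q : {poly C}) :
  (forall t, P.[t] = Q.[t]) -> P = Q.
Proof.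
move=> PQ; apply/eqP; rewrite -subr_eq0; apply/eqP.
by apply: poly_infinite_roots => u _; rewrite hornerD hornerN PQ subrr.
Qed.

Lemma separated_at0 (C : fieldType) (y y' : {poly C}) :
  y.[0] != y'.[0] -> ~~ ('X^2 %| y - y').
Proof.
apply: contra => /(dvdp_trans (dvdp_exp2l 'X (leqnSn 1))).
by rewrite expr1 dvdX_horner0 !hornerE subr_eq0.
Qed.

(** * Places over finite values and at infinity *)

Section ConcretePlaces.

Variables (C : numClosedFieldType) (n : nat) (f : {poly C}).
Hypotheses (n_gt0 : (0 < n)%N) (fm : f \is monic) (sf : size f = n.+1).
Implicit Types (a : 'I_n -> C) (y : 'I_n -> {poly C}).

Lemma generic_fiberE g (y : {poly C}) : (generic_fiber f g).[y] = f \Po y - g.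
Proof. by rewrite /generic_fiber hornerD hornerN hornerC. Qed.

Lemma size_generic_fiber g : size (generic_fiber f g) = n.+1.
Proof.
by rewrite /generic_fiber size_polyDl size_map_polyC sf // size_polyN size_polyC;
   case: (_ == _).
Qed.

Lemma monic_generic_fiber g : generic_fiber f g \is monic.
Proof.
have fm' : f^:P \is monic by apply: monic_map.
rewrite monicE /generic_fiber lead_coefDl; first by rewrite -monicE.
by rewrite size_map_polyC sf size_polyN size_polyC; case: (_ == _).
Qed.

Lemma finite_place N (g : {poly C}) y : (1 < size g)%N -> (size g <= n.+1)%N ->
  (forall i j, i != j -> ~~ ('X^2 %| y i - y j)) ->
  (forall i, 'X^(N + n) %| f \Po y i - g) -> place f N (generic_fiber f g) y.
Proof.
move=> g1 gn yy fy.
have surj z : exists u, g.[u] = z.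
  have /closed_rootP[u] : size (g - z%:P) != 1%N.
    rewrite size_polyDl; first by rewrite gtn_eqF.
    by rewrite size_polyN size_polyC (leq_ltn_trans _ g1) //; case: (_ == _).
  by rewrite rootE !hornerE subr_eq0 => /eqP gu; exists u.
split.
- move=> k; rewrite /generic_fiber coefB coef_map coefC /=.
  case: ifP => [/eqP k0|_]; last by rewrite subr0 (leq_trans (size_polyC_leq1 _)).
  rewrite (leq_trans (size_polyD _ _)) // size_polyN geq_max.
  rewrite (leq_trans (size_polyC_leq1 _)) // (leq_trans gn) //.
  by have := ltn_ord k; lia.
- move=> k _; apply: eq_modX_factor; rewrite ?monic_generic_fiber //.
    exact: size_generic_fiber.
  by move=> i; rewrite generic_fiberE.
- move=> u _; have [x fx] := fiber_exists g.[u] n_gt0 fm sf.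
  exists g.[u], x, 1; split=> //; rewrite generic_fiber_horner -fx.
  by under [RHS]eq_bigr do rewrite mul1r.
- move=> z x _ fx; have [u gu] := surj z; exists u, 1; split; first exact: oner_neq0.
  rewrite generic_fiber_horner gu -fx.
  by under [RHS]eq_bigr do rewrite mul1r.
Qed.

Lemma hensel_fiber (x : C) (g : {poly C}) N : f.[x] = g.[0] -> f^`().[x] != 0 ->
  exists2 y : {poly C}, y.[0] = x & 'X^N %| f \Po y - g.
Proof.
move=> fx dfx; have [||y y0 yN] := @hensel_modX C (generic_fiber f g) x _ _ N.
- by rewrite generic_fiberE !hornerE horner_comp !hornerE fx subrr.
- rewrite /generic_fiber derivB derivC subr0 deriv_map.
  by rewrite -/(_ \Po _) horner_comp hornerC.
by exists y => //; rewrite -generic_fiberE.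
Qed.

(* Each linear form vanishing at [x0] contributes a zero, at the parameter of
   [x0], to the product of all forms, whose degree in the parameter is at most
   [(n-1)!]. *)
Lemma card_relations_bound (x0 a : 'I_n -> C) : fiber f 0 x0 -> injective x0 ->
  ~ vanishing_norm f a ->
  (#|[set s : 'S_n | (\sum_i a i * x0 (s i) == 0)%R]| <= (n.-1)`!)%N.
Proof.
move=> fx0 inj0 nW.
have f0 : f = \prod_i ('X - (x0 i)%:P) by rewrite fx0 polyC0 subr0.
have simple i : f^`().[x0 i] != 0.
  rewrite f0 (bigD1 i) //= derivM derivXsubC mul1r hornerD hornerM.
  rewrite !hornerE subrr mul0r addr0 horner_prod.
  by apply/prodf_neq0 => j ji; rewrite !hornerE subr_eq0 (inj_eq inj0) eq_sym.
pose N := n`!.+1.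
have [y hy] : exists y : 'I_n -> {poly C},
    forall i, (y i).[0] = x0 i /\ 'X^(N + n) %| f \Po y i - 'X.
  have ex i : exists z : {poly C}, z.[0] = x0 i /\ 'X^(N + n) %| f \Po z - 'X.
    have [|z z0 zN] := @hensel_fiber (x0 i) 'X (N + n) _ (simple i).
      rewrite hornerX f0 horner_prod (bigD1 i) //= !hornerE subrr mul0r //.
    by exists z.
  by have [y hy] := choice ex; exists y.
have hp : place f N (generic_fiber f 'X) y.
  apply: finite_place; rewrite ?size_polyX //.
    move=> i j ij; apply: separated_at0.
    by rewrite (hy i).1 (hy j).1 (inj_eq inj0).
  by move=> i; case: (hy i).
have [T wT HT] := norm_form_coef a.
have R0 : coef_form (@polyC C) T (generic_fiber f 'X) != 0.
  by apply/eqP => R0; apply: nW; apply/(place_vanishing n_gt0 fm sf hp HT).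
(* Only the constant coefficient of the generic fibre depends on the parameter, and linearly. Up to
   sign it is [e_n], of weight [n] in a norm of weight at most [n!], so its exponent is at most
   [n!/n = (n-1)!]. *)
have sR : (size (coef_form (@polyC C) T (generic_fiber f 'X)) <= (n.-1)`!.+1)%N.
  apply: (size_coef_form_bound (d := fun k : 'I_n => (k == n.-1 :> nat) : nat)).
    move=> k; rewrite /generic_fiber coefB coef_map coefC /=.
    have -> : ((n - k.+1)%N == 0%N) = (k == n.-1 :> nat).
      by apply/eqP/eqP; have := ltn_ord k; lia.
    case: ifP => _; last by rewrite subr0 size_polyC_leq1.
    rewrite (leq_trans (size_polyD _ _)) // size_polyN geq_max.
    by rewrite (leq_trans (size_polyC_leq1 _)) // size_polyX.
  move=> t tT; have kn : (n.-1 < n)%N by rewrite ltn_predL.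
  rewrite (bigD1 (Ordinal kn)) //= eqxx muln1 big1 ?addn0 => [|k kk]; last first.
    have -> : (k == n.-1 :> nat) = false by apply/negbTE.
    by rewrite muln0.
  have := wT t tT; rewrite (bigD1 (Ordinal kn)) //= prednK //.
  move=> /(leq_trans (leq_addr _ _)).
  by rewrite -[X in X`!](prednK n_gt0) factS prednK // mulnC leq_pmul2l.
set S := [set s : 'S_n | _].
have SN : (#|S| <= n`!)%N by rewrite -card_Sn max_card.
rewrite -ltnS; apply: leq_trans sR; rewrite -[(#|S| < _)%N]/(#|S|.+1 <= _)%N.
have : 'X^#|S| %| coef_form (@polyC C) T (generic_fiber f 'X).
  rewrite -eq_modX0.
  apply: (@eq_modX_trans _ _ (\prod_(s : 'S_n) \sum_i (a i)%:P * y (s i))).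
    rewrite eq_modX_sym; apply: (@eq_modXW _ #|S| N); first by rewrite /N ltnW.
    exact: coef_form_place hp HT.
  rewrite eq_modX0 (bigID (mem S)) /= dvdp_mulr // -prodr_const.
  elim/big_rec2: _ => [|s P Q sS PQ]; first exact: dvdpp.
  apply: dvdp_mul => //; rewrite dvdX_horner0 horner_sum.
  move: sS; rewrite inE => /eqP sS; rewrite -[X in _ == X]sS.
  apply/eqP; apply: eq_bigr => i _.
  by rewrite hornerM hornerC (hy _).1.
by move=> /(dvdp_leq R0); rewrite size_polyXn.
Qed.

(** With [z = u^(-n)] this is [u^n (f(Y/u) - z)], the fibre over [z] rescaled by [u]. At [u = 0] it
    becomes [Y^n - 1], with simple roots. *)
Definition infinite_fiber : {poly {poly C}} :=
  \poly_(j < n.+1) ((f`_j)%:P * 'X^(n - j)) - 1.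

Lemma infinite_fiberE (y : {poly C}) :
  infinite_fiber.[y] = \sum_(j < n.+1) (f`_j)%:P * 'X^(n - j) * y ^+ j - 1.
Proof. by rewrite /infinite_fiber hornerD hornerN hornerC horner_poly. Qed.

Lemma f_lead : f`_n = 1.
Proof. by have := monicP fm; rewrite lead_coefE sf. Qed.

Lemma size_infinite_fiber : size infinite_fiber = n.+1.
Proof.
have h : size (\poly_(j < n.+1) ((f`_j)%:P * 'X^(n - j)) : {poly {poly C}}) = n.+1.
  by rewrite size_poly_eq // f_lead subnn mulr1 oner_eq0.
by rewrite /infinite_fiber size_polyDl h // size_polyN size_poly1.
Qed.

Lemma monic_infinite_fiber : infinite_fiber \is monic.
Proof.
rewrite monicE lead_coefE size_infinite_fiber /= coefB coef_poly ltnSn.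
rewrite coef1 gtn_eqF // subr0 f_lead subnn mulr1 //.
Qed.

Lemma infinite_fiber_horner u z x : u != 0 -> z * u ^+ n = 1 -> fiber f z x ->
  map_poly (horner_eval u) infinite_fiber = \prod_(i < n) ('X - (u * x i)%:P).
Proof.
move=> u0 zu fx; apply: poly_eq_horner => t.
have -> : (map_poly (horner_eval u) infinite_fiber).[t] =
    \sum_(j < n.+1) f`_j * u ^+ (n - j) * t ^+ j - 1.
  rewrite -[t in LHS](hornerC t u) -[LHS]/((map_poly (horner_eval u) _).[horner_eval u _]).
  rewrite horner_map /= infinite_fiberE /horner_eval !hornerE horner_sum.
  by congr (_ - _); apply: eq_bigr => j _; rewrite ?hornerE.
transitivity (u ^+ n * (f - z%:P).[t / u]).
  rewrite hornerD hornerN hornerC mulrBr mulrC [u ^+ n * z]mulrC zu.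
  congr (_ - _); rewrite (@horner_coef_wide _ n.+1) ?sf // mulr_suml.
  apply: eq_bigr => j _; rewrite expr_div_n.
  have jn : (j <= n)%N by rewrite -ltnS.
  have -> : u ^+ n = u ^+ (n - j) * u ^+ j by rewrite -exprD subnK.
  by field; rewrite expf_neq0.
rewrite -fx !horner_prod -[X in u ^+ X]card_ord -prodr_const -big_split /=.
by apply: eq_bigr => i _; rewrite !hornerE mulrBr mulrCA mulfV // mulr1.
Qed.

(** One Hensel lift [psi] of the root 1 gives all branches, since [infinite_fiber] is unchanged when
    [u] and [Y] are multiplied by the same [n]-th root of unity. If [psi_1] were zero, 1 would be a
    root modulo [u^2], but the coefficient of [u] in the value at 1 is [f_(n-1)]. *)
Lemma infinite_place N z : (1 < N)%N -> n.-primitive_root z -> f`_n.-1 != 0 ->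
  exists2 psi : {poly C}, psi`_0 = 1 /\ psi`_1 != 0 &
  place f N infinite_fiber (fun i : 'I_n => z ^+ i *: (psi \Po (z ^- i *: 'X))).
Proof.
move=> N1 zP fn1.
have [||psi psi0 psiN] := @hensel_modX C infinite_fiber 1 _ _ (N + n).
- rewrite infinite_fiberE !hornerE big_ord_recr /= subnn f_lead expr0 mulr1.
  rewrite polyC1 expr1n mulr1 hornerD horner_sum big1 ?add0r ?hornerC ?subrr //.
  move=> j _; rewrite !hornerE expr0n subn_eq0 leqNgt ltn_ord /=.
  by rewrite mulr0 mul0r.
- have -> : infinite_fiber^`() = \poly_(j < n) (((f`_j.+1)%:P * 'X^(n - j.+1)) *+ j.+1).
    apply/polyP => j; rewrite coef_deriv coefB coef1 subr0 !coef_poly ltnS.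
    by case: ifP => // _; rewrite mul0rn.
  have kn : (n.-1 < n)%N by rewrite ltn_predL.
  rewrite horner_poly (bigD1 (Ordinal kn)) //= prednK // f_lead subnn expr0 mulr1.
  rewrite polyC1 expr1n mulr1 hornerD horner_sum big1 => [|j jn]; last first.
    have j0 : (n - j.+1 == 0)%N = false.
      by apply/negbTE; apply: contra jn => h; apply/eqP/val_inj => /=;
         have := ltn_ord j; lia.
    by rewrite expr1n mulr1 hornerMn !hornerE expr0n j0 mulr0 mul0rn.
  by rewrite addr0 hornerMn hornerC pnatr_eq0 -lt0n.
exists psi.
  rewrite -horner_coef0; split=> //; apply/eqP => psi1.
  have : eq_modX 2 psi 1.
    apply/dvdXn_coefP => -[|[|//]] _; rewrite coefB coef1 -?horner_coef0.
      by rewrite psi0 subrr.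
    by rewrite psi1 subr0.
  move=> /(eq_modX_horner infinite_fiber) h1.
  have h2 : eq_modX 2 infinite_fiber.[psi] 0.
    by apply: (@eq_modXW _ 2 (N + n)); [lia | rewrite eq_modX0].
  have /dvdXn_coefP/(_ 1%N isT) : 'X^2 %| infinite_fiber.[1].
    by rewrite -eq_modX0; apply: eq_modX_trans h2; rewrite eq_modX_sym.
  rewrite infinite_fiberE coefB coef1 subr0 coef_sum.
  rewrite (bigD1 (inord n.-1)) //= inordK ?ltnS ?leq_pred //.
  rewrite big1 => [|j jn]; last first.
    rewrite expr1n mulr1 coefCM coefXn; case: eqP => [e|_]; last by rewrite mulr0.
    case/eqP: jn; apply: val_inj; rewrite /= inordK ?ltnS ?leq_pred //.
    by have := ltn_ord j; lia.
  rewrite addr0 expr1n mulr1 coefCM coefXn.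
  have -> : (1 == n - n.-1)%N by lia.
  by rewrite mulr1 => /eqP; apply/negP.
have z0 : z != 0.
  by apply: contraTneq isT => z0; have := prim_expr_order zP;
     rewrite z0 expr0n gtn_eqF // => /eqP; rewrite eq_sym oner_eq0.
split.
- move=> k; rewrite coefB coef_poly coef1.
  have kn : (n - k.+1 < n.+1)%N by lia.
  rewrite kn; have -> : (n - (n - k.+1) = k.+1)%N by have := ltn_ord k; lia.
  rewrite (leq_trans (size_polyD _ _)) // size_polyN geq_max.
  rewrite mul_polyC (leq_trans (size_scale_leq _ _)) ?size_polyXn //=.
  by case: eqP => _; rewrite ?size_poly1 ?size_poly0.
- move=> k _; apply: eq_modX_factor.
  + exact: monic_infinite_fiber.
  + exact: size_infinite_fiber.
  + move=> i j ij; apply: separated_at0.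
    rewrite !hornerZ !horner_comp !hornerZ hornerX !mulr0 psi0 !mulr1.
    by rewrite (eq_prim_root_expr zP) !modn_small.
  + move=> i.
    have -> : infinite_fiber.[z ^+ i *: (psi \Po (z ^- i *: 'X))] =
        infinite_fiber.[psi] \Po (z ^- i *: 'X).
      rewrite !infinite_fiberE rmorphB rmorph1 rmorph_sum /=; congr (_ - _).
      apply: eq_bigr => j _; rewrite !rmorphM /= !rmorphXn /= comp_polyC comp_polyX.
      have jn : (j <= n)%N by rewrite -ltnS.
      rewrite !exprZn -!scalerAr -!scalerAl; congr (_ *: _).
      have zij : (z ^+ i) ^+ (n - j) != 0 by rewrite !expf_neq0.
      apply: (mulIf zij); rewrite exprVn mulVf // -exprD subnKC // -exprM mulnC.
      by rewrite exprM (prim_expr_order zP) expr1n.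
    have /dvdpP[q ->] := psiN; rewrite rmorphM rmorphXn /= comp_polyX exprZn.
    by rewrite dvdp_mull // -mul_polyC dvdp_mull.
- move=> u u0; have [x fx] := fiber_exists (u ^- n) n_gt0 fm sf.
  exists (u ^- n), x, u; split=> //; apply: infinite_fiber_horner fx => //.
  by rewrite mulVf ?expf_neq0.
- move=> z' x z'0 fx; have rK := rootCK n_gt0 z'^-1.
  have u0 : n.-root z'^-1 != 0.
    by apply: contraNneq z'0 => r0; move: rK; rewrite r0 expr0n gtn_eqF //= => /eqP;
       rewrite eq_sym invr_eq0.
  exists (n.-root z'^-1), (n.-root z'^-1); split=> //.
  by apply: infinite_fiber_horner fx => //; rewrite rK mulfV.
Qed.

End ConcretePlaces.

(** * Places over critical values *)

Section CriticalPlace.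

Variables (C : numClosedFieldType) (n : nat) (f : {poly C}).
Hypotheses (n_gt1 : (1 < n)%N) (fm : f \is monic) (sf : size f = n.+1).
Hypothesis simple_crit : forall b, f^`().[b] = 0 -> f^`()^`().[b] != 0.
Variables (z : C) (r : 'I_n -> C).
Hypothesis fr : fiber f z r.

Lemma fiber_root_simple i :
  (forall j, j != i -> r j != r i) -> f^`().[r i] != 0.
Proof.
move=> rj; have -> : f^`() = (f - z%:P)^`() by rewrite derivB derivC subr0.
rewrite -fr (bigD1 i) //= derivM derivXsubC mul1r hornerD hornerM.
rewrite !hornerE subrr mul0r addr0 horner_prod.
by apply/prodf_neq0 => j ji; rewrite !hornerE subr_eq0 eq_sym rj.
Qed.

Lemma fiber_root_double i j : i != j -> r i = r j ->
  exists h : {poly C}, [/\ f - z%:P = ('X - (r i)%:P) ^+ 2 * h,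
    h.[r i] != 0, f^`().[r i] = 0 & forall k, k != i -> k != j -> r k != r i].
Proof.
move=> ij rij; pose h := \prod_(k | (k != i) && (k != j)) ('X - (r k)%:P).
have fh : f - z%:P = ('X - (r i)%:P) ^+ 2 * h.
  rewrite -fr (bigD1 i) //= (bigD1 j) //=; last by rewrite eq_sym.
  by rewrite -rij mulrA expr2.
have d1 : f^`() = (('X - (r i)%:P) ^+ 2 * h)^`() by rewrite -fh derivB derivC subr0.
have f'0 : f^`().[r i] = 0.
  rewrite d1 expr2 !(derivM, derivXsubC) !(hornerXsubC, hornerD, hornerM).
  by rewrite subrr !(mul0r, mulr0, addr0).
have hi : h.[r i] != 0.
  have := simple_crit f'0; rewrite d1; apply: contraNneq => h0.
  rewrite expr2 !(derivM, derivD, derivXsubC, derivC).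
  rewrite !(hornerXsubC, hornerD, hornerM, hornerC) h0 subrr.
  by rewrite !(mul0r, mulr0, addr0).
exists h; split=> // k ki kj; apply: contraNneq hi => rki.
by rewrite horner_prod (bigD1 k) ?ki //= !hornerE rki subrr mul0r.
Qed.

(** The default [i] makes a simple root its own partner, so this is an involution on all indices; no
    root is more than double because critical points are simple. *)
Definition partner (i : 'I_n) : 'I_n :=
  odflt i [pick j | (j != i) && (r j == r i)].

Lemma partner_double i j : i != j -> r i = r j -> partner i = j.
Proof.
move=> ij rij; rewrite /partner; case: pickP => [k /andP[ki /eqP rk]|/(_ j)] /=.
  apply/eqP; apply/negPn/negP => kj.
  have [h [_ _ _ /(_ k ki kj)]] := fiber_root_double ij rij.
  by rewrite rk eqxx.
by rewrite eq_sym ij rij eqxx.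
Qed.

Lemma partner_root i : r (partner i) = r i.
Proof. by rewrite /partner; case: pickP => [k /andP[_ /eqP]|]. Qed.

Lemma partnerK : involutive partner.
Proof.
move=> i; case: (eqVneq (partner i) i) => [e|pi]; first by rewrite !e.
by rewrite (partner_double pi) ?partner_root.
Qed.

(** The substitution [Y = b + u s] turns [f(Y) = z + u^2], divided by [u^2], into
    [s^2 h(b + u s) = 1], whose two sides differ by [G]. At [u = 0] its roots are the square roots
    of [1/h(b)], both simple, so Hensel lifting applies to [s]. *)
Lemma hensel_double_root b (h : {poly C}) N :
  f - z%:P = ('X - b%:P) ^+ 2 * h -> h.[b] != 0 ->
  exists2 s : {poly C}, s.[0] != 0 &
    'X^N %| f \Po (b%:P + 'X * s) - (z%:P + 'X^2).
Proof.
move=> fh hb.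
pose G : {poly {poly C}} := 'X^2 * (h^:P \Po (b%:P%:P + 'X%:P * 'X)) - 1.
have GE (s : {poly C}) : G.[s] = s ^+ 2 * (h \Po (b%:P + 'X * s)) - 1.
  rewrite /G hornerD hornerN hornerM hornerXn horner_comp hornerC.
  by rewrite hornerD hornerM !hornerC hornerX.
pose s0 := sqrtC (h.[b]^-1).
have s02 : s0 ^+ 2 = h.[b]^-1 by rewrite sqrtCK.
have s00 : s0 != 0 by rewrite sqrtC_eq0 invr_eq0.
have [||s ss0 sN] := @hensel_modX C G s0 _ _ N.
- rewrite GE -polyC1 hornerD hornerN hornerM horner_exp horner_comp.
  by rewrite !(hornerD, hornerM, hornerC, hornerX) mul0r addr0 s02 mulVf ?subrr.
- rewrite /G derivB derivC subr0 derivM deriv_comp derivXn expr1.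
  rewrite !(derivD, derivC, derivM, derivX, add0r, mul0r, mulr1).
  rewrite [_.[s0%:P]]hornerD !hornerM !hornerC !hornerMn !hornerX.
  rewrite [_.[0]]hornerD !hornerM hornerX !mulr0 addr0 horner_comp.
  rewrite !(hornerD, hornerM, hornerC, hornerX, hornerMn).
  rewrite -/(_ \Po _) horner_comp !(hornerD, hornerM, hornerC, hornerX) mul0r addr0.
  by rewrite mulf_neq0 // -mulr2n mulrn_eq0.
exists s; first by rewrite ss0.
have -> : f \Po (b%:P + 'X * s) - (z%:P + 'X^2) = 'X^2 * G.[s].
  have /(congr1 (fun q => q \Po (b%:P + 'X * s))) := fh.
  rewrite rmorphB rmorphM rmorphXn rmorphB /= comp_polyX !comp_polyC.
  rewrite addrAC subrr add0r opprD addrA => ->.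
  by rewrite GE mulrBr mulr1 mulrA exprMn.
exact: dvdp_mull.
Qed.

Lemma comp_Xn_dvd N k (p : {poly C}) : (0 < k)%N ->
  'X^N %| p -> 'X^N %| p \Po 'X^k.
Proof.
move=> k0 /dvdpP[q ->]; rewrite rmorphM rmorphXn /= comp_polyX dvdp_mull //.
by rewrite -exprM dvdp_exp2l // leq_pmull.
Qed.

Lemma comp_NX_dvd N (p : {poly C}) : 'X^N %| p -> 'X^N %| p \Po (- 'X).
Proof.
move=> /dvdpP[q ->]; rewrite rmorphM rmorphXn /= comp_polyX dvdp_mull //.
by rewrite exprNn dvdp_mull.
Qed.

(* At a critical value [z], parametrised by [z + u^2], the symmetry [u -> -u]
   exchanges the two branches through each critical point. *)
Lemma critical_place N : exists (tau : 'S_n) (y : 'I_n -> {poly C}),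
  [/\ place f N (generic_fiber f (z%:P + 'X^2)) y,
      forall i, tau (tau i) = i,
      forall i, r (tau i) = r i,
      forall i j, i != j -> r i = r j -> tau i = j
    & forall M a, lin_rel M a y -> lin_rel M (fun i => a (tau i)) y].
Proof.
(* The series is chosen as a function of the root, not of the index, so that partners share it. *)
have [s hs] : exists s : C -> {poly C}, forall b h,
    f - z%:P = ('X - b%:P) ^+ 2 * h -> h.[b] != 0 ->
    (s b).[0] != 0 /\ 'X^(N + n) %| f \Po (b%:P + 'X * s b) - (z%:P + 'X^2).
  have ex b : exists s, forall h,
    f - z%:P = ('X - b%:P) ^+ 2 * h -> h.[b] != 0 ->
    s.[0] != 0 /\ 'X^(N + n) %| f \Po (b%:P + 'X * s) - (z%:P + 'X^2).
    case: (pselect (exists h, f - z%:P = ('X - b%:P) ^+ 2 * h /\ h.[b] != 0)).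
      move=> [h [fh hb]]; have [s s0 sN] := hensel_double_root (N + n) fh hb.
      by exists s.
    by move=> nex; exists 0 => h fh hb; case: nex; exists h.
  by have [s hs] := choice ex; exists s => b; apply: hs.
have [w hw] : exists w : 'I_n -> {poly C}, forall i, f^`().[r i] != 0 ->
    (w i).[0] = r i /\ 'X^(N + n) %| f \Po w i - (z%:P + 'X).
  have ex i : exists w : {poly C}, f^`().[r i] != 0 ->
      w.[0] = r i /\ 'X^(N + n) %| f \Po w - (z%:P + 'X).
    case: (eqVneq f^`().[r i] 0) => [|di]; first by exists 0.
    have [|w w0 wN] := @hensel_fiber C f (r i) (z%:P + 'X) (N + n) _ di.
      have /(congr1 (fun q => q.[r i])) := fr; rewrite horner_prod (bigD1 i) //=.
      rewrite hornerXsubC subrr mul0r hornerD hornerN hornerC => /eqP.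
      by rewrite eq_sym subr_eq0 => /eqP ->; rewrite hornerD hornerC hornerX addr0.
    by exists w.
  by have [w hw] := choice ex; exists w.
pose tau := perm (can_inj partnerK).
have tauE i : tau i = partner i by rewrite permE.
(* A simple root has a branch in [z + u], taken here at [u^2]. Of two partners, the smaller index
   gets the branch in [u], the other the branch in [-u]. *)
pose y i := if partner i == i then w i \Po 'X^2
  else if (i < partner i)%N then (r i)%:P + 'X * s (r i)
  else ((r i)%:P + 'X * s (r i)) \Po (- 'X).
have simple i : partner i = i -> f^`().[r i] != 0.
  move=> pi; apply: fiber_root_simple => j ji; apply: contra_neq ji => rj.
  by rewrite -pi; case: (eqVneq i j) => [<-//|ij]; rewrite (partner_double ij).
have y0 i : (y i).[0] = r i.
  rewrite /y; case: eqP => [pi|_].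
    by rewrite horner_comp hornerXn expr0n; apply: (hw i (simple i pi)).1.
  case: ifP => _; first by rewrite !(hornerD, hornerC, hornerM, hornerX) mul0r addr0.
  by rewrite horner_comp hornerN hornerX oppr0 !(hornerD, hornerC, hornerM, hornerX) mul0r addr0.
have NX2 : (- 'X) ^+ 2 = 'X^2 :> {poly C} by rewrite sqrrN.
have NXNX (q : {poly C}) : (q \Po (- 'X)) \Po (- 'X) = q.
  by rewrite -comp_polyA rmorphN /= comp_polyX opprK comp_polyXr.
have ytau i : y (partner i) = y i \Po (- 'X).
  rewrite /y partnerK partner_root eq_sym; case: eqP => [pi|/eqP npi].
    by rewrite pi -comp_polyA rmorphXn /= comp_polyX NX2.
  case: ltngtP => [lt|gt|/val_inj e]; [by rewrite NXNX | by [] |].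
  by rewrite e eqxx in npi.
have hd i : partner i != i -> (s (r i)).[0] != 0 /\
    'X^(N + n) %| f \Po ((r i)%:P + 'X * s (r i)) - (z%:P + 'X^2).
  rewrite eq_sym => pi.
  have [h [fh hb _ _]] := fiber_root_double pi (esym (partner_root i)).
  exact: hs fh hb.
exists tau, y; split.
- apply: finite_place => //; first exact: ltnW.
  + by rewrite addrC size_polyDl size_polyXn // size_polyC; case: (_ == _).
  + by rewrite addrC size_polyDl size_polyXn // size_polyC; case: (_ == _).
  + move=> i j ij; case: (eqVneq (r i) (r j)) => [rij|]; last first.
      by move=> rij; apply: separated_at0; rewrite !y0.
    have pij := partner_double ij rij; have pii : partner i != i by rewrite pij eq_sym.
    have [s0 _] := hd i pii; rewrite -pij ytau.
    have key (q : {poly C}) : q.[0] != 0 -> ~~ ('X^2 %| (q + (q \Po (- 'X))) * 'X).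
      move=> q0; rewrite expr2 dvdp_mul2r ?polyX_eq0 //. rewrite dvdX_horner0.
      rewrite hornerD horner_comp hornerN hornerX oppr0 -mulr2n mulrn_eq0 //.
    have -> : y i - (y i \Po - 'X) = (if (i < partner i)%N then 1 else -1) *
        ((s (r i) + (s (r i) \Po (- 'X))) * 'X).
      rewrite /y (negbTE pii); case: ifP => _; rewrite ?NXNX.
        rewrite rmorphD rmorphM /= comp_polyC comp_polyX; ring.
      rewrite rmorphD rmorphM /= comp_polyC comp_polyX; ring.
    by case: ifP => _; rewrite ?mul1r ?mulN1r ?dvdpNr; apply: key.
  + move=> i; rewrite /y; case: eqP => [pi|/eqP pi].
      have [_ /(comp_Xn_dvd (isT : (0 < 2)%N))] := hw i (simple i pi).
      by rewrite rmorphB rmorphD /= comp_polyX comp_polyC -comp_polyA.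
    have [_ hdi] := hd i pi; case: ifP => // _.
    have := comp_NX_dvd hdi; rewrite rmorphB rmorphD rmorphXn /= comp_polyX comp_polyC.
    by rewrite NX2 comp_polyA.
- by move=> i; rewrite !tauE partnerK.
- by move=> i; rewrite tauE partner_root.
- by move=> i j ij rij; rewrite tauE (partner_double ij).
- move=> M a ya; rewrite /lin_rel (reindex_inj (@perm_inj _ tau)) /=.
  have -> : \sum_i (a (tau (tau i)))%:P * y (tau i) =
      (\sum_i (a i)%:P * y i) \Po (- 'X).
    rewrite rmorph_sum /=; apply: eq_bigr => i _.
    by rewrite !tauE partnerK ytau rmorphM /= comp_polyC.
  exact: comp_NX_dvd.
Qed.

End CriticalPlace.

(** * Consequences of a linear relation with constant coefficients *)

Section LinearRelation.

Variables (C : numClosedFieldType) (p : nat) (f : {poly C}) (zeta : C).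
Hypotheses (pp : prime p) (zP : p.-primitive_root zeta).
Hypotheses (fm : f \is monic) (sf : size f = p.+1) (fp1 : f`_p.-1 != 0).
Variable a : 'I_p -> C.
Hypotheses (Wa : vanishing_norm f a) (a_neq0 : exists i, a i != 0).

(** The coefficient of [u^m] in the sum of the [b_i y_i] is [psi_m] times the Fourier sum of [b] at
    frequency [1 - m], so [K] collects the [1 - m], [m <= M], with [psi_m] nonzero. Frequency 1
    comes from [psi_0 = 1], and frequency 0 from [psi_1], that is from [f_(p-1) != 0]. *)
Lemma infinite_fourier M N : (0 < M)%N -> (1 < N)%N ->
  exists (K : pred 'F_p) (y : 'I_p -> {poly C}),
  [/\ K 0, K 1, place f N (infinite_fiber p f) y &
   forall b, lin_rel M.+1 b y <-> fourier_vanish zeta K b].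
Proof.
move=> M0 N1.
have [psi [psi0 psi1] hp] := infinite_place (prime_gt0 pp) fm sf N1 zP fp1.
pose K := [pred k : 'F_p | [exists m : 'I_M.+1, (psi`_m != 0) && (k == 1 - m%:R)]].
have M1 : (1 < M.+1)%N by [].
exists K, (fun i : 'I_p => zeta ^+ i *: (psi \Po (zeta ^- i *: 'X))); split=> //.
- by apply/existsP; exists (Ordinal M1); rewrite psi1 subrr eqxx.
- by apply/existsP; exists ord0; rewrite psi0 oner_eq0 subr0 eqxx.
have z0 : zeta != 0.
  apply: contraTneq isT => z0; have := prim_expr_order zP.
  by rewrite z0 expr0n gtn_eqF ?prime_gt0 // => /eqP; rewrite eq_sym oner_eq0.
move=> b; have cE m : (\sum_i (b i)%:P * (zeta ^+ i *: (psi \Po (zeta ^- i *: 'X))))`_m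
    = psi`_m * \sum_i b i * @Fp_char C p zeta (i%:R * (1 - m%:R)).
  rewrite coef_sum mulr_sumr; apply: eq_bigr => i _.
  have -> : @Fp_char C p zeta (i%:R * (1 - m%:R)) = zeta ^+ i * zeta ^- i ^+ m.
    rewrite mulrBr mulr1; apply: (mulIf (x := zeta ^+ (i * m))).
      by rewrite expf_neq0.
    rewrite -(Fp_char_nat pp zP (i * m)) natrM -(Fp_charD pp zP) subrK.
    rewrite -natrM !(Fp_char_nat pp zP) -mulrA exprVn exprM mulVf ?mulr1 //.
    by rewrite !expf_neq0.
  rewrite coefCM coefZ.
  have -> : (psi \Po (zeta ^- i *: 'X))`_m = psi`_m * zeta ^- i ^+ m.
    rewrite comp_polyE coef_sum.
    case: (ltnP m (size psi)) => hm.
      rewrite (bigD1 (Ordinal hm)) //= big1 => [|j jm].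
        by rewrite exprZn !coefZ coefXn eqxx mulr1 addr0.
      rewrite exprZn !coefZ coefXn; case: eqP => [e|_]; last by rewrite !mulr0.
      by case/eqP: jm; apply: val_inj.
    rewrite [in RHS]nth_default // mul0r big1 // => j _.
    rewrite exprZn !coefZ coefXn; case: eqP => [e|_]; last by rewrite !mulr0.
    by have := ltn_ord j; rewrite -e ltnNge hm.
  by ring.
split.
  move=> /dvdXn_coefP hb k /existsP[m /andP[pm /eqP ->]].
  by apply: (mulfI pm); rewrite -cE hb ?mulr0.
move=> hb; apply/dvdXn_coefP => m mM; rewrite cE.
have [->|pm] := eqVneq psi`_m 0; first by rewrite mul0r.
by rewrite hb ?mulr0 //; apply/existsP; exists (Ordinal mM); rewrite pm eqxx.
Qed.

(** In ['F_2] the frequencies 0 and 1 are all there are, so only the zero relation satisfies both;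
    precision [M = 1] already exhibits them. *)
Lemma no_relation_p2 : p != 2.
Proof.
apply/eqP => p2.
have N1 : (1 < (1 * p`!).+1)%N by rewrite ltnS mul1n fact_gt0.
have [K [y [K0 K1 hp hK]]] := @infinite_fourier 1 (1 * p`!).+1 isT N1.
have [s /hK hs] := vanishing_norm_rel (prime_gt0 pp) fm sf hp (leqnn _) Wa.
have key q : q = 2 -> q.-primitive_root zeta -> forall (b : 'I_q -> C) j,
    b j != 0 -> \sum_i b i * zeta ^+ i = 0 -> \sum_i b i = 0 -> False.
  move=> -> zP2 b j bj; rewrite !big_ord_recl !big_ord0 /= !addr0.
  rewrite expr0 mulr1 expr1 => e1 e0.
  have z1 : zeta != 1.
    by apply/eqP => z1; have := prim_order_dvd zP2 1; rewrite expr1 z1 eqxx.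
  have /eqP : b (lift ord0 ord0) * (zeta - 1) = 0.
    transitivity ((b ord0 + b (lift ord0 ord0) * zeta) -
        (b ord0 + b (lift ord0 ord0))); first by ring.
    by rewrite e1 e0 subrr.
  rewrite mulf_eq0 subr_eq0 (negbTE z1) orbF => /eqP b1.
  move: e0; rewrite b1 addr0 => b0; case/eqP: bj.
  by case: (unliftP ord0 j) => [k|] -> //; rewrite (ord1 k).
have [i ai] := a_neq0.
apply: (key p p2 zP (fun j => a (s j)) (s^-1 i)%g).
- by rewrite permKV.
- rewrite -[RHS](hs 1 K1); apply: eq_bigr => j _.
  by rewrite mulr1 (Fp_char_nat pp zP).
- rewrite -[RHS](hs 0 K0); apply: eq_bigr => j _.
  by rewrite mulr0 Fp_char0 mulr1.
Qed.

Hypothesis simple_crit : forall b, f^`().[b] = 0 -> f^`()^`().[b] != 0.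

Lemma crit_fiber_square b : f^`().[b] = 0 ->
  exists (al : C) (A : {poly C}), [/\ A \is monic, size A = (p.-1./2).+1 &
    f - (f.[b])%:P = ('X - al%:P) * A ^+ 2].
Proof.
move=> b'0; have p_gt1 := prime_gt1 pp.
have [r fr] := fiber_exists f.[b] (prime_gt0 pp) fm sf.
(* [M + 1] is the precision at which a relation makes the norm vanish; [N] is the precision of the
   branches that yields a factor of the norm divisible by ['X^(M + 1)]. *)
pose M := p`!; pose N := (M * p`!).+1.
have M0 : (0 < M)%N by apply: fact_gt0.
have N1 : (1 < N)%N by rewrite /N ltnS muln_gt0 M0.
have [K [y [K0 K1 hp hK]]] := infinite_fourier M0 N1.
have [t /hK ht] := vanishing_norm_rel (prime_gt0 pp) fm sf hp (leqnn _) Wa.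
have [tau [y' [hp' tauK rtau tau2 ytau]]] := critical_place p_gt1 fm sf simple_crit fr N.
have [s hs] := place_conj (prime_gt0 pp) fm sf hp hp' (leqnn _) (leqnn _).
have [i0 ri0] : exists i, r i = b.
  have : (\prod_i ('X - (r i)%:P)).[b] == 0 by rewrite fr !hornerE subrr.
  rewrite horner_prod => /prodf_eq0[i _]; rewrite hornerXsubC subr_eq0 => /eqP ->.
  by exists i.
have [j0 ji0 rj0] : exists2 j, j != i0 & r j = r i0.
  case: (pickP (fun j => (j != i0) && (r j == r i0))) => [j /andP[ji /eqP]|nj].
    by exists j.
  have := fiber_root_simple fr (i := i0); rewrite ri0 b'0 eqxx => h.
  suff : false by []; apply: h => j ji; have := nj j; rewrite ji ri0 /=.
  by move=> ->.
(* Carried to infinity by [s], the involution [tau] preserves a Fourier space. Two fixed points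
   would make it the identity, but it exchanges [i0] and [j0]. *)
have fix1 i j : tau i = i -> tau j = j -> i = j.
  move=> ti tj; apply/eqP; apply/negPn/negP => ij.
  pose sg := (s^-1 * tau * s)%g.
  have sgE l : sg (s l) = s (tau l) by rewrite !permM permK.
  have sgid : forall l, sg l = l.
    apply: (perm_fourier_fix pp zP K0 K1 ht _ _ _ (i := s i) (j := s j)).
    - case: a_neq0 => l al; exists (t^-1 l)%g; by rewrite permKV.
    - move=> c /hK/hs /ytau hc; apply/hK/hs; move: hc.
      by congr (is_true (lin_rel _ _ _)); apply/funext => l; rewrite sgE.
    - move=> l; rewrite -[l](permKV s) !sgE tauK //.
    - by rewrite (inj_eq perm_inj).
    - by rewrite sgE ti.
    - by rewrite sgE tj.
  have /perm_inj : s (tau i0) = s i0 by rewrite -sgE sgid.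
  rewrite (tau2 i0 j0) 1?eq_sym // => e; by rewrite e eqxx in ji0.
(* One index from each pair exchanged by [tau] gives the polynomial to be squared. The fixed indices
   form [S0], with at most one element by [fix1] and at least one because [p] is odd. *)
pose S1 := [pred i : 'I_p | (i < tau i)%N].
pose S2 := [pred i : 'I_p | (tau i < i)%N].
pose S0 := [pred i : 'I_p | tau i == i].
pose XS (S : pred 'I_p) := \prod_(i | S i) ('X - (r i)%:P).
have monicXS S : XS S \is monic by rewrite monic_prod // => i _; apply: monicXsubC.
have sizeXS S : size (XS S) = #|S|.+1.
  rewrite -[XS S]/(\prod_(i in S) ('X - (r i)%:P)) -big_enum /=.
  by rewrite size_prod_XsubC -cardE.
have fE : f - (f.[b])%:P = XS S0 * XS S1 ^+ 2.
  rewrite -fr expr2 /XS (bigID S0) /=; congr (_ * _).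
  rewrite (bigID S1) /=; congr (_ * _).
    by apply: eq_bigl => i /=; rewrite -val_eqE /=; case: ltngtP.
  rewrite (reindex_inj (@perm_inj _ tau)) /=.
  under eq_bigr => i _ do rewrite rtau.
  by apply: eq_bigl => i; rewrite /= tauK -val_eqE /=; case: ltngtP.
have cS : (#|S0| + #|S1|.*2 = p)%N.
  have sP : size (\prod_i ('X - (r i)%:P)) = p.+1.
    by have := sizeXS predT; rewrite card_ord.
  have := congr1 (fun q : {poly C} => size q) fE.
  rewrite expr2 mulrA !size_Mmonic ?monicXS ?monic_neq0 ?monicMr ?monicXS // !sizeXS.
  rewrite -fr sP !addnS /= -addnn.
  by rewrite addnA => -[] /esym.
have S0le : (#|S0| <= 1)%N.
  by apply/card_le1_eqP => i j /eqP ti /eqP tj; apply: fix1.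
have podd : odd p by case: (even_prime pp) => // p2; have := no_relation_p2; rewrite p2.
have [S01 S1c] : #|S0| = 1%N /\ #|S1| = p.-1./2.
  by move: cS S0le podd; move: #|S0| #|S1| => s0 s1; lia.
have [l Sl] : exists l, S0 =i pred1 l by apply/card1P/eqP.
exists (r l), (XS S1); split=> //; first by rewrite sizeXS S1c.
by rewrite fE {1}/XS (big_pred1 l) // => i; apply: Sl.
Qed.

End LinearRelation.

(** * Chebyshev polynomials *)

Lemma log_deriv_XsubC (F : fieldType) (s : seq F) b : b \notin s ->
  let f := \prod_(c <- s) ('X - c%:P) in
  let s1 := \sum_(c <- s) (b - c)^-1 in
  f^`().[b] = f.[b] * s1 /\
  f^`()^`().[b] = f.[b] * (s1 ^+ 2 - \sum_(c <- s) (b - c) ^- 2).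
Proof.
elim: s => [|c s IH]; first
  by rewrite /= !big_nil -polyC1 derivC deriv0 !horner0 expr2 mul0r subrr !mulr0.
rewrite inE negb_or => /andP[bc /IH /= [e1 e2]].
have bc0 : b - c != 0 by rewrite subr_eq0.
rewrite !big_cons !derivM !derivXsubC !mul1r derivD derivM derivXsubC mul1r.
rewrite !(hornerXsubC, hornerD, hornerM) e1 e2.
by move: (\prod_(j <- s) _).[b] => fb; split; field.
Qed.

(* Gauss-Lucas: at a critical point off the roots, [sum 1/(b - c) = 0] forces
   [b] to be real, and then [f''/f = - sum 1/(b - c)^2 < 0]. *)
Lemma simple_crit_real (C : numClosedFieldType) n (f : {poly C}) (x : 'I_n -> C) :
  (0 < n)%N -> injective x -> (forall i, x i \is Num.real) -> fiber f 0 x ->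
  forall b, f^`().[b] = 0 -> f^`()^`().[b] != 0.
Proof.
move=> n0 xinj xreal fx b f'b.
have fE : f = \prod_(c <- [seq x i | i <- enum 'I_n]) ('X - c%:P).
  by rewrite big_map big_enum /= fx polyC0 subr0.
case: (boolP (b \in [seq x i | i <- enum 'I_n])) => bs.
  have /mapP[i _ bi] := bs; have := fiber_root_simple fx (i := i).
  rewrite -bi f'b eqxx => h; suff : false by []; apply: h => j ji.
  by rewrite bi (inj_eq xinj).
have fb : f.[b] != 0 by rewrite fE -rootE root_prod_XsubC.
have [] := log_deriv_XsubC bs; rewrite -fE f'b => /esym/eqP.
rewrite mulf_eq0 (negbTE fb) /= => /eqP s1 ->.
have bx i : b - x i != 0.
  rewrite subr_eq0; apply: contraNneq bs => ->; apply: map_f.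
  by rewrite mem_enum.
rewrite s1 expr0n sub0r mulf_neq0 // oppr_eq0 big_map big_enum /=.
move: s1; rewrite big_map big_enum /= => s1.
(* As [1/(b - x i)] is [w i] times the conjugate of [b - x i], [s1] says that the conjugate of [b]
   is the barycentre of the real [x i] with positive weights [w i]. *)
pose w i := `|b - x i| ^- 2.
have w0 i : 0 < w i by rewrite invr_gt0 exprn_gt0 // normr_gt0.
have i0 : 'I_n by exact: Ordinal n0.
have sumw : 0 < \sum_i w i.
  rewrite (bigD1 i0) //= ltr_wpDr // sumr_ge0 // => i _; exact: ltW.
have breal : b \is Num.real.
  have : \sum_i w i * (b^* - x i) = 0.
    rewrite -[RHS]s1; apply: eq_bigr => i _; rewrite /w normCK.
    rewrite rmorphB /= (CrealP (xreal i)) invfM -mulrA mulVf ?mulr1 //.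
    by rewrite -(CrealP (xreal i)) -rmorphB /= fmorph_eq0.
  under eq_bigr => i _ do rewrite mulrBr.
  rewrite sumrB -mulr_suml => /eqP; rewrite subr_eq0 => /eqP e.
  have bE : b^* = (\sum_i w i * x i) / (\sum_i w i).
    by rewrite -e mulrC mulKf // gt_eqF.
  have rX : (\sum_i w i * x i) / (\sum_i w i) \is Num.real.
    rewrite realM ?realV ?rpred_sum // => i _; last by rewrite gtr0_real.
    by rewrite realM // gtr0_real.
  by rewrite -(conjCK b) bE (CrealP rX).
rewrite gt_eqF // (bigD1 i0) //=.
have pos i : 0 < (b - x i) ^- 2.
  by rewrite invr_gt0 real_exprn_even_gt0 ?bx ?orbT // realB.
by rewrite ltr_wpDr // sumr_ge0 // => i _; exact: ltW.
Qed.

Section Chebyshev.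

Variables (C : numClosedFieldType) (q : nat) (f : {poly C}).
Local Notation p := q.*2.+1.
Hypotheses (q_gt0 : (0 < q)%N) (fm : f \is monic) (sf : size f = p.+1).
Hypothesis simple_crit : forall b, f^`().[b] = 0 -> f^`()^`().[b] != 0.
Hypothesis crit_square : forall b, f^`().[b] = 0 ->
  exists (al : C) (A : {poly C}), [/\ A \is monic, size A = q.+1 &
    f - (f.[b])%:P = ('X - al%:P) * A ^+ 2].

(** Differentiating [f - z1 = (X - al1) A1^2] gives [f' = A1 Q]. A root [b2] of [Q] lies over
    another critical value: over [z1], either [A1(b2) = 0] and [f''(b2) = 0], or [b2 = al1], where
    [Q] and [A1] agree, so that again [A1(b2) = 0]. *)
Lemma two_crit_squares : exists z1 z2 al1 al2 (A1 A2 : {poly C}),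
  [/\ z1 != z2, A1 \is monic /\ size A1 = q.+1, A2 \is monic /\ size A2 = q.+1,
      f - z1%:P = ('X - al1%:P) * A1 ^+ 2 & f - z2%:P = ('X - al2%:P) * A2 ^+ 2].
Proof.
have f'p : f^`()`_q.*2 != 0.
  have := monicP fm; rewrite lead_coefE sf /= coef_deriv => ->.
  by rewrite pnatr_eq0.
have sf' : (q.*2 < size f^`())%N.
  by rewrite ltnNge; apply: contra f'p => h; rewrite nth_default.
have [b1 b10] : exists b, f^`().[b] = 0.
  have /closed_rootP[b /rootP] : size f^`() != 1%N by rewrite gtn_eqF //; lia.
  by exists b.
have [al1 [A1 [A1m sA1 fA1]]] := crit_square b10.
pose Q := A1 + ('X - al1%:P) * A1^`() *+ 2.
have f'E : f^`() = A1 * Q.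
  transitivity (f - (f.[b1])%:P)^`(); first by rewrite derivB derivC subr0.
  rewrite fA1 expr2 !derivM derivXsubC /Q mulr2n; ring.
have sQ : size Q != 1%N.
  have := size_polyMleq A1 Q; rewrite -f'E sA1 => h; apply/eqP => Q1.
  by move: h; rewrite Q1; lia.
have [b2 /rootP Qb2] := closed_rootP _ sQ.
have b20 : f^`().[b2] = 0 by rewrite f'E hornerM Qb2 mulr0.
have [al2 [A2 [A2m sA2 fA2]]] := crit_square b20.
exists f.[b1], f.[b2], al1, al2, A1, A2; split=> //.
apply/eqP => e; have := congr1 (fun g => g.[b2]) fA1.
rewrite hornerM hornerXsubC horner_exp hornerD hornerN hornerC -e subrr => /esym/eqP.
rewrite mulf_eq0 expf_eq0 /=.
case: (eqVneq A1.[b2] 0) => [A10 _|A10].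
  have := simple_crit b20; rewrite f'E derivM hornerD !hornerM A10 Qb2.
  by rewrite mulr0 mul0r addr0 eqxx.
rewrite orbF subr_eq0 => /eqP b2al; move: Qb2; rewrite /Q hornerD hornerMn hornerM.
by rewrite hornerXsubC b2al subrr mul0r mul0rn addr0 -b2al => h; rewrite h eqxx in A10.
Qed.

(** The factor [s^(2q)] clears the poles at 0, as [A] has degree [q]. The value at 0 is what
    determines [b - a] in [chebyshev_form]. *)
Lemma laurent_comp (A : {poly C}) (c rho : C) : size A = q.+1 ->
  exists2 H : {poly C}, H.[0] = lead_coef A * rho ^+ q &
    forall s, s != 0 -> H.[s] = s ^+ q.*2 * A.[c + rho * (s ^+ 2 + s ^- 2)].
Proof.
move=> sA.
exists (\sum_(j < q.+1) A`_j *: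
   ((c *: 'X^2 + rho *: ('X^4 + 1)) ^+ j * 'X^((q - j).*2))).
  rewrite horner_sum big_ord_recr /= big1 => [|j _].
    rewrite add0r subnn expr0 mulr1 hornerZ horner_exp lead_coefE sA /=.
    by rewrite !(hornerD, hornerZ, hornerXn) !expr0n /= hornerC mulr0 !add0r mulr1.
  rewrite hornerZ hornerM hornerXn expr0n double_eq0 subn_eq0 leqNgt ltn_ord /=.
  by rewrite !mulr0.
move=> s s0; rewrite horner_sum (@horner_coef_wide _ q.+1) ?sA // mulr_sumr.
apply: eq_bigr => j _; rewrite hornerZ hornerM horner_exp !hornerXn.
rewrite !(hornerD, hornerZ, hornerXn) hornerC.
have jq : (j <= q)%N by rewrite -ltnS.
have -> : q.*2 = (j.*2 + (q - j).*2)%N by rewrite -doubleD subnKC.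
rewrite [s ^+ (_ + _)]exprD -[j.*2]mul2n exprM [RHS]mulrCA; congr (_ * _).
rewrite [RHS]mulrAC -exprMn; congr (_ ^+ _ * _); by field.
Qed.

(* With [t = c + rho (s + 1/s)], [s = w^2], the two square roots of [f - z2]
   and [f - z1] are Laurent polynomials in [w] whose difference of squares is
   constant, so their sum and difference are monomials. *)
Lemma chebyshev_form : exists c rho kappa : C, rho != 0 /\
  forall s, s != 0 ->
    f.[c + rho * (s + s^-1)] = kappa + rho ^+ p * (s ^+ p + s ^- p).
Proof.
have [z1 [z2 [al1 [al2 [A1 [A2 [z12 [A1m sA1] [A2m sA2] f1 f2]]]]]]] := two_crit_squares.
(* Chosen so that [al1 = c + 2 rho] and [al2 = c - 2 rho]: then [T s - al1 = rho (s - 1/s)^2] and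
   [T s - al2 = rho (s + 1/s)^2]. *)
pose c := (al1 + al2) / 2%:R; pose rho := (al1 - al2) / 4%:R.
have n2 : 2%:R != 0 :> C by rewrite pnatr_eq0.
have n4 : 4%:R != 0 :> C by rewrite pnatr_eq0.
have al1E : al1 = c + rho * 2%:R by rewrite /c /rho; field.
have al2E : al2 = c - rho * 2%:R by rewrite /c /rho; field.
have rho0 : rho != 0.
  rewrite mulf_neq0 ?invr_neq0 // subr_eq0; apply: contra_neq z12 => e.
  have := congr1 (fun g => g.[al1]) f1; have := congr1 (fun g => g.[al2]) f2.
  rewrite !hornerM !hornerXsubC !subrr !mul0r !hornerD !hornerN !hornerC e.
  by move=> /eqP; rewrite subr_eq0 => /eqP <- /eqP; rewrite subr_eq0 => /eqP <-.
pose th := sqrtC rho; have th2 : th ^+ 2 = rho by rewrite sqrtCK.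
have th0 : th != 0 by rewrite sqrtC_eq0.
pose T (s : C) := c + rho * (s ^+ 2 + s ^- 2).
have [H1 H10 H1E] := laurent_comp c rho sA1.
have [H2 H20 H2E] := laurent_comp c rho sA2.
rewrite (eqP A1m) mul1r in H10; rewrite (eqP A2m) mul1r in H20.
pose a := th *: (('X^2 - 1) * H1); pose b := th *: (('X^2 + 1) * H2).
have f1E s : f.[T s] = z1 + (T s - al1) * A1.[T s] ^+ 2.
  have := congr1 (fun g => g.[T s]) f1.
  rewrite hornerM hornerXsubC horner_exp hornerD hornerN hornerC => <-.
  by rewrite addrC subrK.
have f2E s : f.[T s] = z2 + (T s - al2) * A2.[T s] ^+ 2.
  have := congr1 (fun g => g.[T s]) f2.
  rewrite hornerM hornerXsubC horner_exp hornerD hornerN hornerC => <-.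
  by rewrite addrC subrK.
have sp s : s ^+ (q.*2.+1).*2 = (s ^+ q.*2 * s) ^+ 2 :> C.
  by rewrite -exprSr -exprM muln2.
have aE s : s != 0 -> a.[s] ^+ 2 = s ^+ (q.*2.+1).*2 * (f.[T s] - z1).
  move=> s0; rewrite f1E addrC addKr /a hornerZ hornerM H1E // -/(T s) sp.
  rewrite !(hornerD, hornerN, hornerXn) hornerC.
  move: (A1.[T s]) (s ^+ q.*2) => A u; rewrite exprMn th2 /T al1E; by field.
have bE s : s != 0 -> b.[s] ^+ 2 = s ^+ (q.*2.+1).*2 * (f.[T s] - z2).
  move=> s0; rewrite f2E addrC addKr /b hornerZ hornerM H2E // -/(T s) sp.
  rewrite !(hornerD, hornerN, hornerXn) hornerC.
  move: (A2.[T s]) (s ^+ q.*2) => A u; rewrite exprMn th2 /T al2E; by field.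
have ab : (b - a) * (b + a) = (z1 - z2) *: 'X^((q.*2.+1).*2).
  apply/eqP; rewrite -subr_eq0; apply/eqP; apply: poly_infinite_roots => s s0.
  rewrite hornerD hornerN hornerM (hornerD b (- a)) (hornerD b a) (hornerN a).
  rewrite (hornerZ (z1 - z2)) hornerXn.
  have -> : (b.[s] - a.[s]) * (b.[s] + a.[s]) = b.[s] ^+ 2 - a.[s] ^+ 2 by ring.
  by rewrite aE // bE //; ring.
(* The value of [b - a] at 0. It is nonzero and [b - a] divides a power of ['X], so [b - a] is the
   constant [u]. *)
pose u := (th * rho ^+ q) *+ 2.
have u0 : u != 0 by rewrite mulrn_eq0 /= mulf_neq0 // expf_neq0.
have ba0 : (b - a).[0] = u.
  rewrite hornerD hornerN /a /b !hornerZ !hornerM H10 H20.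
  by rewrite !(hornerD, hornerN, hornerXn) !hornerC !expr0n /= /u; ring.
have baC : b - a = u%:P.
  have : b - a %| ('X - 0%:P) ^+ (q.*2.+1).*2.
    rewrite subr0 -(@dvdpZr _ (z1 - z2)) ?subr_eq0 // -ab; exact: dvdp_mulr.
  move=> /dvdp_exp_XsubCP[k _ bak].
  have k0 : k = 0%N.
    case: k bak => // k; rewrite exprS => /eqpP[[d1 d2] /= /andP[d10 d20]].
    move=> /(congr1 (fun g => g.[0])); rewrite !hornerZ ba0 hornerM hornerXsubC subrr.
    by rewrite mul0r mulr0 => /eqP; rewrite mulf_eq0 (negbTE d10) (negbTE u0).
  move: bak; rewrite k0 expr0 => /eqp_size; rewrite size_poly1 => s1.
  by rewrite (size1_polyC (eq_leq s1)) -horner_coef0 ba0.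
pose v := (z1 - z2) / u.
have baV : b + a = v *: 'X^((q.*2.+1).*2).
  apply: (@mulfI _ u%:P); first by rewrite polyC_eq0.
  by rewrite -[in LHS]baC ab mul_polyC scalerA /v mulrC divfK.
have b2 : b *+ 2 = u%:P + v *: 'X^((q.*2.+1).*2) by rewrite -baC -baV mulr2n; ring.
have bh s : b.[s] = (u + v * s ^+ (q.*2.+1).*2) / 2%:R.
  have := congr1 (fun g => g.[s]) b2; rewrite hornerMn (hornerD u%:P) hornerC (hornerZ v) hornerXn.
  by move=> <-; rewrite -mulr_natr mulfK.
(* [b] is palindromic, because [T] is invariant under [s -> 1/s]. Comparing [s = 2] with [s = 1/2]
   suffices, as [2^(2p) != 1]. *)
have uv : u = v.
  have s0 : 2%:R != 0 :> C := n2.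
  have bs : b.[2%:R^-1] * 2%:R ^+ (q.*2.+1).*2 = b.[2%:R].
    rewrite /b !hornerZ !hornerM !H2E ?invr_eq0 // !exprVn !invrK.
    rewrite [2%:R ^- 2 + _]addrC sp !(hornerD, hornerXn) !hornerC.
    rewrite exprVn; move: (A2.[_]) (2%:R ^+ q.*2) (expf_neq0 q.*2 s0) => A P P0.
    by field; rewrite P0.
  move: bs; rewrite !bh exprVn; set w := 2%:R ^+ _ => e.
  have w0 : w != 0 by rewrite expf_neq0.
  have w1 : w - 1 != 0.
    rewrite subr_eq0 /w -natrX -[1]/(1%:R) eqr_nat gtn_eqF //.
    by rewrite -[X in (X < _)%N](expn0 2) ltn_exp2l.
  have : (u - v) * (w - 1) = 0.
    transitivity (((u + v / w) / 2%:R * w - (u + v * w) / 2%:R) * 2%:R).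
      by field; rewrite w0.
    by rewrite e subrr mul0r.
  by move=> /eqP; rewrite mulf_eq0 (negbTE w1) orbF subr_eq0 => /eqP.
exists c, rho, (z2 + rho ^+ p *+ 2); split=> // s s0.
pose w := sqrtC s; have w2 : w ^+ 2 = s by rewrite sqrtCK.
have w0 : w != 0 by rewrite sqrtC_eq0.
have -> : c + rho * (s + s^-1) = T w by rewrite /T w2.
have wE : w ^+ (q.*2.+1).*2 = s ^+ p by rewrite -mul2n exprM w2.
have sp0 : s ^+ p != 0 by rewrite expf_neq0.
have alg0 (t R S : C) : (t * R *+ 2 + t * R *+ 2 * S) / 2%:R = t * R * (1 + S).
  by rewrite !mulr2n; field.
have bw : b.[w] = th * rho ^+ q * (1 + s ^+ p) by rewrite bh wE -uv /u alg0.
have e : rho * (rho ^+ q) ^+ 2 * (1 + s ^+ p) ^+ 2 = s ^+ p * (f.[T w] - z2).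
  by rewrite -wE -bE // bw wE -th2 -!exprMn.
have -> : f.[T w] = z2 + (s ^+ p)^-1 * (rho * (rho ^+ q) ^+ 2 * (1 + s ^+ p) ^+ 2).
  by rewrite e mulKf // addrC subrK.
have alg (y t R S : C) : S != 0 ->
    y + S^-1 * (t * R ^+ 2 * (1 + S) ^+ 2) = y + t * R ^+ 2 *+ 2 + t * R ^+ 2 * (S + S^-1).
  by move=> S0; rewrite mulr2n; field.
have -> : rho ^+ p = rho * (rho ^+ q) ^+ 2 by rewrite exprS -exprM muln2.
exact: alg.
Qed.

End Chebyshev.

(** * The dihedral group acting on F_p *)

Section DihedralPerm.

Variables (p : nat).
Hypotheses (pp : prime p) (p_gt2 : (2 < p)%N).

Definition dih_fun (u : 'F_p * bool) (i : 'I_p) : 'I_p :=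
  ord_Fp pp (u.1 + (-1) ^+ u.2 * i%:R).

Lemma dih_fun_inj u : injective (dih_fun u).
Proof.
move=> i j /(congr1 (fun k : 'I_p => k%:R : 'F_p)); rewrite !ord_FpK => /addrI.
move=> /(mulrI (unitrX _ (unitrN1 _))) /(congr1 (ord_Fp pp)).
by rewrite !Fp_ordK.
Qed.

Definition dih u : 'S_p := perm (@dih_fun_inj u).

Definition dih_set : {set 'S_p} := [set dih u | u : 'F_p * bool].

Lemma dihE u i : (dih u i)%:R = u.1 + (-1) ^+ u.2 * i%:R :> 'F_p.
Proof. by rewrite permE ord_FpK. Qed.

Lemma Fp_ord_inj (i j : 'I_p) : i%:R = j%:R :> 'F_p -> i = j.
Proof. by move=> /(congr1 (ord_Fp pp)); rewrite !Fp_ordK. Qed.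

Lemma dihM u w : (dih u * dih w)%g = dih (w.1 + (-1) ^+ w.2 * u.1, u.2 (+) w.2).
Proof.
apply/permP => i; apply: Fp_ord_inj; rewrite permM !dihE /= signr_addb.
by rewrite mulrDr addrA mulrA [(-1) ^+ w.2 * (-1) ^+ _]mulrC.
Qed.

Lemma dih1 : dih (0, false) = 1%g.
Proof.
by apply/permP => i; apply: Fp_ord_inj; rewrite dihE /= perm1 add0r expr0 mul1r.
Qed.

Lemma dih_group : group_set dih_set.
Proof.
apply/group_setP; split; first by apply/imsetP; exists (0, false); rewrite // dih1.
by move=> _ _ /imsetP[u _ ->] /imsetP[w _ ->]; rewrite dihM; apply: imset_f.
Qed.

Lemma two_neq0 : 2%:R != 0 :> 'F_p.
Proof.
rewrite -(dvdn_pcharf (pchar_Fp pp)); apply/negP => /dvdn_leq; lia.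
Qed.

Lemma dih_inj : injective dih.
Proof.
move=> [b s] [b' s'] e.
have E (x : 'F_p) : b + (-1) ^+ s * x = b' + (-1) ^+ s' * x.
  have := congr1 (fun t : 'S_p => (t (ord_Fp pp x))%:R : 'F_p) e.
  by rewrite !dihE /= natr_Zp.
have bb : b = b' by have := E 0; rewrite !mulr0 !addr0.
congr (_, _) => //; have := E 1; rewrite bb => /addrI; rewrite !mulr1.
have n1 : (1 : 'F_p) = -1 -> False.
  move=> h; case/negP: two_neq0; rewrite (natrD _ 1 1) {1}h addNr //.
by case: s s' {E e} => [] [] //= h; case: n1; rewrite ?expr0 ?expr1 in h.
Qed.

Lemma card_dih : #|dih_set| = (2 * p)%N.
Proof.
by rewrite card_imset; [rewrite card_prod card_Fp // card_bool mulnC | apply: dih_inj].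
Qed.

(** The reflections [x : i -> -i] and [y : i -> 1 - i] are distinct involutions whose product is the
    translation by 1, so they generate [dih_set]; two distinct involutions always generate a
    dihedral group. *)
Lemma dih_set_isog : (dih_set \isog 'D_(2 * p))%g.
Proof.
pose x := dih (0, true); pose y := dih (1, true).
have ord2 b : #[dih (b, true)]%g = 2%N.
  apply/(@nt_prime_order _ 2) => //.
    rewrite expgS expg1 dihM /= -dih1; congr (dih (_, _)).
    by rewrite expr1 mulN1r subrr.
  by rewrite -dih1 (inj_eq dih_inj) xpair_eqE andbF.
have xy : x != y.
  by rewrite (inj_eq dih_inj) xpair_eqE eq_sym oner_eq0.
have trans k : ((x * y) ^+ k)%g = dih (k%:R, false).
  elim: k => [|k IH]; first by rewrite expg0 -dih1.
  rewrite expgSr IH !dihM /=; congr (dih (_, _)).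
  by rewrite expr0 mulr0 addr0 mul1r -[in RHS]addn1 natrD addrC.
have gen : <<[set x; y]>>%g = dih_set.
  apply/eqP; rewrite finset.eqEsubset; apply/andP; split.
    rewrite -[dih_set]/(gval (Group dih_group)) gen_subG; apply/fintype.subsetP => t.
    by rewrite !inE => /orP[] /eqP ->; apply: imset_f.
  have xG : x \in <<[set x; y]>>%g by rewrite mem_gen // !inE eqxx.
  have yG : y \in <<[set x; y]>>%g by rewrite mem_gen // !inE eqxx orbT.
  apply/fintype.subsetP => _ /imsetP[[b s] _ ->].
  have tG : dih (b, false) \in <<[set x; y]>>%g.
    by rewrite -[b]natr_Zp -trans groupX // groupM.
  case: s => //; have -> : dih (b, true) = (x * dih (b, false))%g.
    by rewrite dihM /= mulr0 addr0.
  by rewrite groupM.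
have := involutions_gen_dihedral (ord2 0) (ord2 1) xy.
by rewrite -/x -/y gen card_dih.
Qed.

End DihedralPerm.

(** * The curve of a Chebyshev polynomial *)

Section Polyfun.

Local Open Scope classical_set_scope.

Variables (K : comNzRingType) (n : nat).
Implicit Types (f g : ('I_n -> K) -> K) (V W A B : set ('I_n -> K)).

Lemma polyfun_sub f g : polyfun f -> polyfun g -> polyfun (fun x => f x - g x).
Proof.
move=> pf pg; have := pf_add pf (pf_mul (pf_const n (-1)) pg).
by congr polyfun; apply/funext => x; rewrite mulN1r.
Qed.

Lemma polyfun_sum (I : Type) (r : seq I) (F : I -> ('I_n -> K) -> K) :
  (forall i, polyfun (F i)) -> polyfun (fun x => \sum_(i <- r) F i x).
Proof.
move=> pF; elim: r => [|i r IH].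
  by have := pf_const n (0 : K); congr polyfun; apply/funext => x; rewrite big_nil.
have := pf_add (pF i) IH; congr polyfun; apply/funext => x; by rewrite big_cons.
Qed.

Lemma polyfun_permact f (s : 'S_n) :
  polyfun f -> polyfun (fun x => f (permact s x)).
Proof.
elim=> [c|i|{}f g _ pf _ pg|{}f g _ pf _ pg]; first exact: pf_const.
- exact: (pf_var K (s i)).
- exact: pf_add.
- exact: pf_mul.
Qed.

Lemma permactM (s t : 'S_n) (x : 'I_n -> K) :
  permact s (permact t x) = permact (s * t)%g x.
Proof. by apply/funext => i; rewrite /permact permM. Qed.

Lemma permact1 (x : 'I_n -> K) : permact 1%g x = x.
Proof. by apply/funext => i; rewrite /permact perm1. Qed.

Lemma permactK (s : 'S_n) : cancel (permact s) (permact (T := K) s^-1%g).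
Proof. by move=> x; rewrite permactM mulVg permact1. Qed.

Lemma permactVK (s : 'S_n) : cancel (permact s^-1%g) (permact (T := K) s).
Proof. by move=> x; rewrite permactM mulgV permact1. Qed.

Lemma image_permactE (s : 'S_n) V x : (permact s @` V) x <-> V (permact s^-1%g x).
Proof.
split=> [[y Vy <-]|Vx]; first by rewrite permactK.
by exists (permact s^-1%g x); rewrite ?permactVK.
Qed.

Lemma image_permactM (s t : 'S_n) V :
  permact s @` (permact t @` V) = permact (s * t)%g @` V.
Proof. by rewrite image_comp; congr image; apply/funext => x; rewrite /= permactM. Qed.

Lemma image_permact1 V : permact 1%g @` V = V.
Proof. by rewrite -[RHS]image_id; congr image; apply/funext => x; rewrite permact1. Qed.

Lemma zariski_closed_image (s : 'S_n) V :
  zariski_closed V -> zariski_closed (permact s @` V).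
Proof.
move=> [S [Spoly VS]]; exists [set g | exists2 f, S f & g = fun x => f (permact s^-1%g x)].
split=> [g [f Sf ->]|x]; first exact: polyfun_permact (Spoly f Sf).
rewrite image_permactE VS; split=> [Sx g [f Sf ->]|Sx f Sf]; first exact: Sx.
by apply: (Sx (fun x => f (permact s^-1%g x))); exists f.
Qed.

Lemma irreducible_image (s : 'S_n) V :
  irreducible_closed V -> irreducible_closed (permact s @` V).
Proof.
move=> [Vc [x0 Vx0] Virr]; split; first exact: zariski_closed_image.
  by exists (permact s x0); exists x0.
move=> A B Ac Bc VAB.
have [||x Vx|h|h] := Virr (permact s^-1%g @` A) (permact s^-1%g @` B).
- exact: zariski_closed_image.
- exact: zariski_closed_image.
- case: (VAB (permact s x)) => [|Ax|Bx]; first by exists x.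
    by left; apply/image_permactE; rewrite invgK.
  by right; apply/image_permactE; rewrite invgK.
- by left=> _ [x Vx <-]; have /image_permactE := h x Vx; rewrite invgK.
- by right=> _ [x Vx <-]; have /image_permactE := h x Vx; rewrite invgK.
Qed.

End Polyfun.

Section PolyfunIdomain.

Local Open Scope classical_set_scope.

Variables (K : idomainType) (n : nat).
Implicit Types (V W A B : set ('I_n -> K)).

Lemma zariski_closedU A B :
  zariski_closed A -> zariski_closed B -> zariski_closed (A `|` B).
Proof.
move=> [S [Sp AS]] [T [Tp BT]].
exists [set h | exists f g, [/\ S f, T g & h = fun x => f x * g x]].
split=> [h [f [g [Sf Tg ->]]]|x]; first by apply: pf_mul; [apply: Sp | apply: Tp].
split=> [[/AS Ax|/BT Bx] h [f [g [Sf Tg ->]]]|Hx].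
- by rewrite (Ax f Sf) mul0r.
- by rewrite (Bx g Tg) mulr0.
have [Ax|nA] := pselect (A x); first by left.
right; apply/BT => g Tg; apply: contrapT => gx; apply: nA; apply/AS => f Sf.
have /eqP : f x * g x = 0 by apply: (Hx (fun x => f x * g x)); exists f, g.
by rewrite mulf_eq0 => /orP[/eqP|/eqP].
Qed.

Lemma zariski_closed0 : zariski_closed (set0 : set ('I_n -> K)).
Proof.
exists [set (fun=> 1)]; split=> [f ->|x]; first exact: pf_const.
by split=> // /(_ _ erefl) /eqP; rewrite oner_eq0.
Qed.

Lemma irreducible_sub_finite_union V (I : eqType) (r : seq I) (F : I -> set ('I_n -> K)) :
  irreducible_closed V -> (forall i, zariski_closed (F i)) ->
  (forall x, V x -> exists2 i, i \in r & F i x) -> exists i, V `<=` F i.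
Proof.
move=> [_ [x0 Vx0] Virr] Fc.
have Uc (l : seq I) : zariski_closed [set x | exists2 i, i \in l & F i x].
  elim: l => [|i l IH].
    have -> : [set x | exists2 i, i \in [::] & F i x] = set0.
      by rewrite -subset0 => x [].
    exact: zariski_closed0.
  have -> : [set x | exists2 j, j \in i :: l & F j x] =
      F i `|` [set x | exists2 j, j \in l & F j x].
    apply/seteqP; split=> x /=.
      by move=> [j]; rewrite inE => /predU1P[->|jl] Fx; [left | right; exists j].
    case=> [Fx|[j jl Fx]]; first by exists i; rewrite // inE eqxx.
    by exists j; rewrite // inE jl orbT.
  exact: zariski_closedU.
elim: r => [|i r IH] VF; first by have [] := VF x0 Vx0.
have [||x Vx|h|h] := Virr (F i) [set x | exists2 j, j \in r & F j x].
- exact: Fc.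
- exact: Uc.
- have [j] := VF x Vx; rewrite inE => /predU1P[->|jr] Fx; first by left.
  by right; exists j.
- by exists i.
- exact: IH.
Qed.

End PolyfunIdomain.

(** * The parametrised curve: closedness, irreducibility, stabiliser *)

Section ChebyshevCurve.

Local Open Scope classical_set_scope.

Variables (C : numClosedFieldType) (p : nat) (zeta c rho : C).
Hypotheses (pp : prime p) (p_gt2 : (2 < p)%N) (zP : p.-primitive_root zeta).
Hypothesis (rho0 : rho != 0).

Local Notation e := (@Fp_char C p zeta).

Definition cheb_point (w : C) : 'I_p -> C :=
  fun i => c + rho * (e i%:R * w + e (- i%:R) * w^-1).

Definition cheb_curve : set ('I_p -> C) :=
  [set x | exists2 w, w != 0 & x = cheb_point w].

(** A normalised discrete Fourier coefficient. It inverts the parametrisation: frequency [-1]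
    returns [w] and frequency [1] returns [1/w], two different frequencies as [p > 2], while [c]
    contributes to frequency 0 alone. *)
Definition cheb_coord (k : 'F_p) (x : 'I_p -> C) : C :=
  (p%:R * rho)^-1 * \sum_(i < p) e (i%:R * k) * x i.

Lemma p_neq0 : p%:R != 0 :> C.
Proof. by rewrite pnatr_eq0 -lt0n prime_gt0. Qed.

Lemma Fp_char_neq0 x : e x != 0.
Proof.
apply/eqP => ex; have := Fp_charD pp zP x (- x); rewrite subrr Fp_char0 ex mul0r.
by move/eqP; rewrite oner_eq0.
Qed.

Lemma Fp_char_inj x y : e x = e y -> x = y.
Proof.
move=> exy; apply/eqP; rewrite -subr_eq0 -(Fp_char_eq1 pp zP).
by rewrite (Fp_charD pp zP) exy -(Fp_charD pp zP) subrr Fp_char0.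
Qed.

Lemma sum_ord_char k : \sum_(i < p) e (i%:R * k) = if k == 0 then p%:R else 0.
Proof. by rewrite (sum_ord_Fp pp (fun x => e (x * k))) (sum_Fp_char pp zP). Qed.

Lemma cheb_coord_point k w : k != 0 ->
  cheb_coord k (cheb_point w) =
  (if k == -1 then w else 0) + (if k == 1 then w^-1 else 0).
Proof.
move=> k0; rewrite /cheb_coord /cheb_point.
transitivity ((p%:R * rho)^-1 * (c * (\sum_(i < p) e (i%:R * k)) +
   rho * (w * (\sum_(i < p) e (i%:R * (k + 1))) +
          w^-1 * (\sum_(i < p) e (i%:R * (k - 1)))))).
  congr (_ * _); rewrite !mulr_sumr -!big_split /= mulr_sumr -big_split /=.
  apply: eq_bigr => i _; rewrite !mulrDr mulr1 mulrN1 !(Fp_charD pp zP); ring.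
rewrite !sum_ord_char (negbTE k0) mulr0 add0r addr_eq0 subr_eq0.
have := p_neq0.
move: (w^-1) => w1.
by case: ifP => _; case: ifP => _ p0; field; rewrite rho0 p0.
Qed.

Lemma opp1_neq1 : (-1 : 'F_p) != 1.
Proof.
apply/eqP => h; case/negP: (two_neq0 pp p_gt2).
by rewrite (natrD _ 1 1) -[X in X + _]h addNr.
Qed.

Lemma cheb_coordN w : cheb_coord (-1) (cheb_point w) = w.
Proof.
rewrite cheb_coord_point ?oppr_eq0 ?oner_eq0 // eqxx.
by rewrite (negbTE opp1_neq1) addr0.
Qed.

Lemma cheb_coord1 w : cheb_coord 1 (cheb_point w) = w^-1.
Proof.
rewrite cheb_coord_point ?oner_eq0 // eqxx eq_sym.
by rewrite (negbTE opp1_neq1) add0r.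
Qed.

Lemma polyfun_cheb_coord k : polyfun (cheb_coord k).
Proof.
apply: pf_mul; first exact: pf_const.
by apply: polyfun_sum => i; apply: pf_mul; [apply: pf_const | apply: pf_var].
Qed.

(** The curve is an affine embedding of the hyperbola [X Y = 1]: [h] is its equation in the Fourier
    coordinates [-1] and [1], and the [g i] express every [x i] through these two. *)
Lemma cheb_curve_closed : zariski_closed cheb_curve.
Proof.
pose g i (x : 'I_p -> C) := x i -
  (c + rho * (e i%:R * cheb_coord (-1) x + e (- i%:R) * cheb_coord 1 x)).
pose h x := cheb_coord (-1) x * cheb_coord 1 x - 1.
exists [set f | f = h \/ exists i, f = g i]; split.
  move=> f [->|[i ->]].
    apply: polyfun_sub; last exact: pf_const.
    by apply: pf_mul; apply: polyfun_cheb_coord.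
  apply: polyfun_sub; first exact: pf_var.
  apply: pf_add; first exact: pf_const.
  apply: pf_mul; first exact: pf_const.
  by apply: pf_add; apply: pf_mul;
     [apply: pf_const | apply: polyfun_cheb_coord | apply: pf_const
     | apply: polyfun_cheb_coord].
move=> x; split=> [[w w0 ->] f [->|[i ->]]|H].
- by rewrite /h cheb_coordN cheb_coord1 mulfV ?subrr.
- by rewrite /g cheb_coordN cheb_coord1 subrr.
have /eqP := H h (or_introl erefl); rewrite subr_eq0 => /eqP xy.
have x0 : cheb_coord (-1) x != 0.
  by apply/eqP => x0; move: xy => /eqP; rewrite x0 mul0r eq_sym oner_eq0.
exists (cheb_coord (-1) x) => //; apply/funext => i.
have /eqP := H (g i) (or_intror (ex_intro _ i erefl)); rewrite subr_eq0 => /eqP ->.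
rewrite /cheb_point; congr (_ + _ * (_ + _ * _)).
by apply: (mulfI x0); rewrite xy mulfV.
Qed.

Lemma polyfun_cheb_point (f : ('I_p -> C) -> C) : polyfun f ->
  exists (q : {poly C}) m, forall w, w != 0 -> f (cheb_point w) = q.[w] / w ^+ m.
Proof.
elim=> [a|i|{}f g _ [q [m qE]] _ [r [k rE]]|{}f g _ [q [m qE]] _ [r [k rE]]].
- by exists a%:P, 0%N => w w0; rewrite hornerC expr0 divr1.
- exists (c *: 'X + rho *: (e i%:R *: 'X^2 + (e (- i%:R))%:P)), 1%N => w w0.
  rewrite !(hornerD, hornerZ) hornerX hornerXn hornerC /cheb_point; by field.
- exists (q * 'X^k + r * 'X^m), (m + k)%N => w w0; rewrite qE // rE //.
  rewrite hornerD !hornerM !hornerXn exprD; field; by rewrite !expf_neq0.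
- exists (q * r), (m + k)%N => w w0; rewrite qE // rE // hornerM exprD.
  by field; rewrite !expf_neq0.
Qed.

(** Along the parametrisation polynomial functions become Laurent polynomials in [w], and these have
    no zero divisors. *)
Lemma cheb_curve_irreducible : irreducible_closed cheb_curve.
Proof.
split; first exact: cheb_curve_closed.
  by exists (cheb_point 1), 1; rewrite ?oner_eq0.
move=> A B [S [Sp AS]] [T [Tp BT]] ZAB; apply: contrapT => /not_orP[nA nB].
have nex V (U : set (('I_p -> C) -> C)) : (forall x, V x <-> (forall f, U f -> f x = 0)) ->
    ~ (cheb_curve `<=` V) -> exists f w, [/\ U f, w != 0 & f (cheb_point w) != 0].
  move=> VU nV; apply: contrapT => nE; apply: nV => x [w w0 ->].
  apply/VU => f Uf; apply: contrapT => /eqP fw; apply: nE; by exists f, w.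
have [f [w [Sf w0 fw]]] := nex _ _ AS nA.
have [g [u [Tg u0 gu]]] := nex _ _ BT nB.
have [q [m qE]] := polyfun_cheb_point (Sp f Sf).
have [r [k rE]] := polyfun_cheb_point (Tp g Tg).
have qr0 : q * r = 0.
  apply: poly_infinite_roots => t t0; rewrite hornerM.
  have : f (cheb_point t) = 0 \/ g (cheb_point t) = 0.
    have [|Ax|Bx] := ZAB (cheb_point t); first by exists t.
      by left; apply: (AS _).1.
    by right; apply: (BT _).1.
  rewrite qE // rE // => -[] /eqP; rewrite mulf_eq0 invr_eq0 expf_eq0 (negbTE t0) andbF orbF.
    by move=> /eqP ->; rewrite mul0r.
  by move=> /eqP ->; rewrite mulr0.
move/eqP: qr0; rewrite mulf_eq0 => /orP[] /eqP q0.
  by move: fw; rewrite qE // q0 horner0 mul0r eqxx.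
by move: gu; rewrite rE // q0 horner0 mul0r eqxx.
Qed.

Lemma dih_cheb_point (u : 'F_p * bool) w : w != 0 ->
  exists2 w', w' != 0 & permact (dih pp u) (cheb_point w) = cheb_point w'.
Proof.
case: u => b [] w0.
  exists (e (- b) / w); first by rewrite mulf_neq0 ?invr_neq0 // Fp_char_neq0.
  apply/funext => i; rewrite /permact /cheb_point dihE /= expr1 mulN1r.
  have eb : e (- b) = (e b)^-1.
    by apply: (mulfI (Fp_char_neq0 b));
     rewrite -(Fp_charD pp zP) subrr Fp_char0 mulfV ?Fp_char_neq0.
  rewrite opprB !(Fp_charD pp zP) eb; congr (_ + _).
  have := Fp_char_neq0 b; move: (e b) (e i%:R) (e (- i%:R)) => x y z x0.
  by field; rewrite x0 w0.
exists (e b * w); first by rewrite mulf_neq0 // Fp_char_neq0.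
apply/funext => i; rewrite /permact /cheb_point dihE /= expr0 mul1r.
have eb : e (- b) = (e b)^-1.
  by apply: (mulfI (Fp_char_neq0 b));
     rewrite -(Fp_charD pp zP) subrr Fp_char0 mulfV ?Fp_char_neq0.
rewrite opprD !(Fp_charD pp zP) eb; congr (_ + _).
have := Fp_char_neq0 b; move: (e b) (e i%:R) (e (- i%:R)) => x y z x0.
by field; rewrite x0 w0.
Qed.

(** If [s] preserves the curve, it sends the point of [w] to that of some [w'] with
    [w' = al w + be/w] and [1/w' = ga w + de/w]. The product being 1 forces [al ga = 0]. Comparing
    coordinates gives [e(s i) = al e(i) + ga e(-i)], so [s] is a reflection if [al = 0] and a
    translation if [ga = 0]. *)
Lemma cheb_stab (s : 'S_p) :
  permact s @` cheb_curve = cheb_curve <-> s \in dih_set pp.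
Proof.
have sub (t : 'S_p) : t \in dih_set pp -> permact t @` cheb_curve `<=` cheb_curve.
  move=> /imsetP[u _ ->] _ [_ [w w0 ->] <-].
  by have [w' w'0 ->] := dih_cheb_point u w0; exists w'.
split=> [sZ|sD]; last first.
  apply/seteqP; split; first exact: sub.
  move=> x Zx; apply/image_permactE; apply: (sub s^-1%g).
    have := groupVr (G := Group (dih_group pp)) sD; exact.
  by exists x.
have sP w : w != 0 -> exists2 w', w' != 0 & permact s (cheb_point w) = cheb_point w'.
  move=> w0; have : (permact s @` cheb_curve) (permact s (cheb_point w)).
    by exists (cheb_point w) => //; exists w.
  by rewrite sZ => -[w' w'0 e']; exists w'.
pose al := p%:R^-1 * \sum_(i < p) e (- i%:R) * e (s i)%:R.
pose be := p%:R^-1 * \sum_(i < p) e (- i%:R) * e (- (s i)%:R).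
pose ga := p%:R^-1 * \sum_(i < p) e i%:R * e (s i)%:R.
pose de := p%:R^-1 * \sum_(i < p) e i%:R * e (- (s i)%:R).
have p0 := p_neq0.
have lin k w : k != 0 -> cheb_coord k (permact s (cheb_point w)) =
    p%:R^-1 * (\sum_(i < p) e (i%:R * k) * e (s i)%:R) * w +
    p%:R^-1 * (\sum_(i < p) e (i%:R * k) * e (- (s i)%:R)) * w^-1.
  move=> k0; rewrite /cheb_coord /permact /cheb_point.
  transitivity ((p%:R * rho)^-1 * (c * (\sum_(i < p) e (i%:R * k)) +
     rho * (w * (\sum_(i < p) e (i%:R * k) * e (s i)%:R) +
            w^-1 * (\sum_(i < p) e (i%:R * k) * e (- (s i)%:R))))).
    congr (_ * _); rewrite !mulr_sumr -!big_split /= mulr_sumr -big_split /=.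
    by apply: eq_bigr => i _; ring.
  rewrite sum_ord_char (negbTE k0) mulr0 add0r.
  move: (w^-1) (\sum_(i < p) _) (\sum_(i < p) _) => w1 x y; by field; rewrite rho0 p0.
have w'E w w' : permact s (cheb_point w) = cheb_point w' ->
    w' = al * w + be * w^-1 /\ w'^-1 = ga * w + de * w^-1.
  move=> E; split.
    rewrite -[LHS]cheb_coordN -E lin ?oppr_eq0 ?oner_eq0 //.
    by under eq_bigr => i _ do rewrite mulrN1;
       under [X in _ + _ * X * _]eq_bigr => i _ do rewrite mulrN1.
  rewrite -[LHS]cheb_coord1 -E lin ?oner_eq0 //.
  by under eq_bigr => i _ do rewrite mulr1;
     under [X in _ + _ * X * _]eq_bigr => i _ do rewrite mulr1.
have P1 : (al *: 'X^2 + be%:P) * (ga *: 'X^2 + de%:P) = 'X^2.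
  apply/eqP; rewrite -subr_eq0; apply/eqP; apply: poly_infinite_roots => w w0.
  have [w' w'0 /w'E[e1 e2]] := sP w w0.
  rewrite hornerD hornerN hornerM !hornerD !hornerZ !hornerXn !hornerC.
  have : w' * w'^-1 = 1 by rewrite mulfV.
  rewrite e2 e1 => e3.
  transitivity (w ^+ 2 * ((al * w + be * w^-1) * (ga * w + de * w^-1) - 1)); first by field.
  by rewrite e3 subrr mulr0.
have P2 (i : 'I_p) : e (s i)%:R *: 'X^2 + (e (- (s i)%:R))%:P =
    e i%:R *: (al *: 'X^2 + be%:P) + e (- i%:R) *: (ga *: 'X^2 + de%:P).
  apply/eqP; rewrite -subr_eq0; apply/eqP; apply: poly_infinite_roots => w w0.
  have [w' w'0 E] := sP w w0; have [e1 e2] := w'E w w' E.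
  have := congr1 (fun x => x i) E; rewrite /permact /cheb_point => /addrI /(mulfI rho0).
  rewrite e2 e1 => e3.
  rewrite !(hornerD, hornerN, hornerZ, hornerXn, hornerC).
  transitivity (w * ((e (s i)%:R * w + e (- (s i)%:R) * w^-1) -
    (e i%:R * (al * w + be * w^-1) + e (- i%:R) * (ga * w + de * w^-1)))); first by field.
  by rewrite e3 subrr mulr0.
have alga : al * ga = 0.
  have := congr1 (fun q : {poly C} => q`_4) P1.
  have -> : (al *: 'X^2 + be%:P) * (ga *: 'X^2 + de%:P) =
      (al * ga) *: 'X^4 + (al * de + be * ga) *: 'X^2 + (be * de)%:P.
    by rewrite -!mul_polyC polyCD !polyCM; ring.
  by rewrite !(coefD, coefZ, coefXn, coefC) /= !(mulr1, mulr0, addr0).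
have eE i : e (s i)%:R = e i%:R * al + e (- i%:R) * ga.
  have := congr1 (fun q : {poly C} => q`_2) (P2 i).
  by rewrite !(coefD, coefZ, coefXn, coefC) /= !(mulr1, addr0).
pose b : 'F_p := (s (ord_Fp pp 0))%:R.
have eb : e b = al + ga by rewrite eE ord_FpK oppr0 Fp_char0 !mul1r.
move/eqP: alga; rewrite mulf_eq0 => /orP[] /eqP z.
  apply/imsetP; exists (b, true) => //; apply/permP => i; apply: (Fp_ord_inj pp).
  apply: Fp_char_inj; rewrite dihE /= expr1 mulN1r (Fp_charD pp zP) eb eE z.
  by rewrite mulr0 !add0r mulrC.
apply/imsetP; exists (b, false) => //; apply/permP => i; apply: (Fp_ord_inj pp).
apply: Fp_char_inj; rewrite dihE /= expr0 mul1r (Fp_charD pp zP) eb eE z.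
by rewrite mulr0 !addr0 mulrC.
Qed.

End ChebyshevCurve.

Lemma joukowski_surj (C : numClosedFieldType) (m : C) :
  exists2 s, s != 0 & s + s^-1 = m.
Proof.
pose d := sqrtC (m ^+ 2 - 4%:R); have d2 : d ^+ 2 = m ^+ 2 - 4%:R by rewrite sqrtCK.
have n2 : 2%:R != 0 :> C by rewrite pnatr_eq0.
have st : (m + d) / 2%:R * ((m - d) / 2%:R) = 1.
  transitivity ((m ^+ 2 - d ^+ 2) / 4%:R); first by field.
  by rewrite d2; field.
have s0 : (m + d) / 2%:R != 0.
  by apply/eqP => s0; move/eqP: st; rewrite s0 mul0r eq_sym oner_eq0.
exists ((m + d) / 2%:R) => //.
have -> : ((m + d) / 2%:R)^-1 = (m - d) / 2%:R.
  by apply: (mulfI s0); rewrite st mulfV.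
by field.
Qed.

(** * Fibres of a Chebyshev polynomial and components of its curve *)

Section ChebyshevFiber.

Local Open Scope classical_set_scope.

Variables (C : numClosedFieldType) (p : nat) (zeta c rho kappa : C) (f : {poly C}).
Hypotheses (pp : prime p) (zP : p.-primitive_root zeta) (rho0 : rho != 0).
Hypothesis fE : forall s, s != 0 ->
  f.[c + rho * (s + s^-1)] = kappa + rho ^+ p * (s ^+ p + s ^- p).

Local Notation e := (@Fp_char C p zeta).
Local Notation pt := (@cheb_point C p zeta c rho).

Lemma prod_sub_char (s w : C) :
  \prod_(i < p) (s - e i%:R * w) = s ^+ p - w ^+ p.
Proof.
have [->|w0] := eqVneq w 0.
  under eq_bigr => i _ do rewrite mulr0 subr0.
  by rewrite prodr_const card_ord expr0n gtn_eqF ?prime_gt0 // subr0.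
have := congr1 (fun q : {poly C} => q.[s / w]) (factor_Xn_sub_1 zP).
rewrite big_mkord horner_prod !hornerE => h.
transitivity (w ^+ p * ((s / w) ^+ p - 1)); last first.
  by rewrite expr_div_n mulrBr mulr1 mulrC divfK // expf_neq0.
rewrite -h -[X in w ^+ X]card_ord -prodr_const -big_split /=.
apply: eq_bigr => i _; rewrite hornerXsubC (Fp_char_nat pp zP).
by rewrite mulrBr mulrCA mulfV // mulr1 [w * _]mulrC.
Qed.

Lemma prod_sub_charN (s w : C) :
  \prod_(i < p) (s - e (- i%:R) * w) = s ^+ p - w ^+ p.
Proof.
rewrite -prod_sub_char.
have H (G : 'F_p -> C) : \prod_(i < p) G i%:R = \prod_x G x.
  rewrite [RHS](reindex (fun i : 'I_p => i%:R)) //=.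
  by exists (ord_Fp pp) => x _; [apply: Fp_ordK | apply: ord_FpK].
rewrite (H (fun x => s - e (- x) * w)) (H (fun x => s - e x * w)).
by rewrite [RHS](reindex_inj (@oppr_inj 'F_p)).
Qed.

Lemma fiber_cheb_point w : w != 0 ->
  fiber f (kappa + rho ^+ p * (w ^+ p + w ^- p)) (pt w).
Proof.
move=> w0; apply: poly_eq_horner => t.
have [s s0 ts] := joukowski_surj ((t - c) / rho).
have {ts} -> : t = c + rho * (s + s^-1) by rewrite ts mulrC divfK // addrC subrK.
rewrite hornerD hornerN hornerC fE // horner_prod.
(* In the variable [s] each [t - x_i] splits into two linear factors, and each family of factors
   multiplies to a difference of [p]-th powers. *)
transitivity (\prod_(i < p) (rho * s^-1 * ((s - e i%:R * w) * (s - e (- i%:R) * w^-1)))).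
  apply: eq_bigr => i _; rewrite hornerXsubC /cheb_point.
  have ee : e i%:R * e (- i%:R) = 1 by rewrite -(Fp_charD pp zP) subrr Fp_char0.
  transitivity (rho * s^-1 * (s ^+ 2 + e i%:R * e (- i%:R) - s * (e i%:R * w + e (- i%:R) * w^-1))).
    by rewrite ee; move: (w^-1) => w1; field.
  by congr (_ * _); field.
rewrite big_split /= prodr_const card_ord big_split /= prod_sub_char prod_sub_charN.
rewrite !exprMn !exprVn.
have sp : s ^+ p != 0 by rewrite expf_neq0.
have wp : w ^+ p != 0 by rewrite expf_neq0.
move: (s ^+ p) (w ^+ p) (rho ^+ p) sp wp => S W R sp wp; field; by rewrite sp wp.
Qed.

Lemma fiber_inj_perm n (g : {poly C}) z (x y : 'I_n -> C) :
  fiber g z x -> fiber g z y -> exists s : 'S_n, x = permact s y.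
Proof.
move=> gx gy.
have : \prod_(a <- [tuple x i | i < n]) ('X - a%:P) =
       \prod_(a <- [tuple y i | i < n]) ('X - a%:P).
  rewrite !big_tuple; under eq_bigr do rewrite tnth_mktuple.
  by under [RHS]eq_bigr do rewrite tnth_mktuple; rewrite gx gy.
move=> /prod_XsubC_eq /tuple_permP[s xs]; exists s; apply/funext => i.
have := congr1 (fun t : n.-tuple C => tnth t i) (val_inj xs).
by rewrite !tnth_mktuple.
Qed.

(** Solving [z = kappa + rho^p (y + 1/y)] and [y = w^p] gives a point of the curve in the same
    fibre; two points of one fibre differ by a permutation. *)
Lemma fiber_cheb_curve z x : fiber f z x ->
  exists s : 'S_p, (permact s @` @cheb_curve C p zeta c rho) x.
Proof.
move=> fx; have [y y0 ym] := joukowski_surj ((z - kappa) / rho ^+ p).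
pose w := p.-root y; have wp : w ^+ p = y by rewrite rootCK ?prime_gt0.
have w0 : w != 0.
  by apply: contraNneq y0 => w0; rewrite -wp w0 expr0n gtn_eqF ?prime_gt0.
have fw := fiber_cheb_point w0.
rewrite wp ym mulrC divfK ?expf_neq0 // addrC subrK in fw.
have [s ->] := fiber_inj_perm fx fw.
by exists s, (pt w) => //; exists w.
Qed.

Hypothesis p_gt2 : (2 < p)%N.

(** [V] is the union of finitely many permuted copies of the curve, each irreducible; a component
    lies in one of them and equals it by maximality. Its stabiliser is then a conjugate of that of
    the curve. *)
Lemma component_stab (V W : set ('I_p -> C)) :
  (forall x, V x <-> exists z, fiber f z x) -> irreducible_component V W ->
  exists s : 'S_p, forall t : 'S_p,
    permact t @` W = W <-> (t ^ s)%g \in dih_set pp.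
Proof.
move=> VE [Wirr WV Wmax]; pose Z := @cheb_curve C p zeta c rho.
have Zirr : irreducible_closed Z := cheb_curve_irreducible c pp p_gt2 zP rho0.
have [||s Ws] := @irreducible_sub_finite_union C p W _ (enum 'S_p)
    (fun s : 'S_p => permact s @` Z) Wirr.
- by move=> s; apply: zariski_closed_image; case: Zirr.
- move=> x /WV/VE[z /fiber_cheb_curve[s sx]]; exists s => //.
  by rewrite mem_enum.
have sV : permact s @` Z `<=` V.
  move=> _ [_ [w w0 ->] <-]; apply/VE.
  exists (kappa + rho ^+ p * (w ^+ p + w ^- p)).
  have := fiber_cheb_point w0; rewrite /fiber => <-.
  by rewrite [RHS](reindex_inj (@perm_inj _ s)).
have {Ws} <- : permact s @` Z = W.
  by apply: Wmax => //; apply: irreducible_image.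
exists s => t; rewrite -(cheb_stab c pp p_gt2 zP rho0) -/Z image_permactM conjgE.
split=> [tZ|tZ].
  by rewrite -(image_permactM s^-1%g) tZ image_permactM mulVg image_permact1.
by rewrite -[in RHS]tZ image_permactM mulKVg.
Qed.

End ChebyshevFiber.

(** * The elementary symmetric curve as a union of fibres *)

Lemma coef_prod_XsubC_esym (K : idomainType) n (x : 'I_n -> K) k : (k <= n)%N ->
  (\prod_i ('X - (x i)%:P))`_(n - k) = (-1) ^+ k * Defs.esym k x.
Proof.
move=> kn.
have -> : \prod_i ('X - (x i)%:P) = \prod_(a <- [tuple x i | i < n]) ('X - a%:P).
  by rewrite big_tuple; apply: eq_bigr => i _; rewrite tnth_mktuple.
have kn' : (k < n.+1)%N by [].
rewrite (mroots_coeff _ (Ordinal kn')) /=; congr (_ * _).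
rewrite /mesym /Defs.esym !raddf_sum /=; apply: eq_bigr => B _.
rewrite !rmorph_prod /=; apply: eq_bigr => i _.
by rewrite mevalXU tnth_mktuple.
Qed.

(** Prescribing [e_1, ..., e_(n-1)] fixes all coefficients of the monic polynomial with roots [x]
    except the constant one, which is left to the parameter [z]. *)
Lemma esym_curve_fiber n (v : 'I_n -> Rl) (x : 'I_n -> Cx) : (0 < n)%N ->
  esym_curve v x <->
  exists z, fiber (\prod_i ('X - (Complex (v i) 0)%:P)) z x.
Proof.
move=> n0; pose y i : Cx := Complex (v i) 0; rewrite -/y.
have sz (u : 'I_n -> Cx) : size (\prod_i ('X - (u i)%:P)) = n.+1.
  by rewrite -big_enum /= size_prod_XsubC size_enum_ord.
have mon (u : 'I_n -> Cx) : \prod_i ('X - (u i)%:P) \is monic.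
  by rewrite -big_enum /= monic_prod_XsubC.
split=> [xv|[z xz] k /andP[k0 kn]].
  exists ((\prod_i ('X - (y i)%:P))`_0 - (\prod_i ('X - (x i)%:P))`_0).
  apply/polyP => j; rewrite coefB coefC.
  have [->|j0] := eqVneq j 0%N; first by rewrite opprB addrC subrK.
  rewrite subr0; have [jn|] := ltnP j n.
    have jE : j = (n - (n - j))%N by rewrite subKn // ltnW.
    rewrite jE !coef_prod_XsubC_esym ?leq_subr //; congr (_ * _).
    by apply: xv; rewrite subn_gt0 jn /=; lia.
  rewrite leq_eqVlt => /predU1P[<-|nj]; last by rewrite !nth_default ?sz.
  by have := monicP (mon x); have := monicP (mon y); rewrite !lead_coefE !sz /= => -> ->.
have := congr1 (fun q : {poly Cx} => q`_(n - k)) xz.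
rewrite coefB coefC gtn_eqF ?subn_gt0 // subr0 !coef_prod_XsubC_esym ?(ltnW kn) //.
by apply: mulfI; rewrite expf_neq0 // oppr_eq0 oner_eq0.
Qed.

(** * Counting points of the orbit *)

Lemma prime_prim_root_exists (C : numClosedFieldType) p : prime p ->
  exists z : C, p.-primitive_root z.
Proof.
move=> pp; have p0 := prime_gt0 pp; have p1 := prime_gt1 pp.
pose P : {poly C} := \sum_(i < p) 'X^i.
have PE : 'X^p - 1 = ('X - 1) * P by rewrite subrX1.
have cP (j : nat) : (j < p)%N -> P`_j = 1.
  move=> jp; rewrite coef_sum (bigD1 (Ordinal jp)) //= coefXn eqxx big1 ?addr0 //.
  move=> i ij; rewrite coefXn; case: eqP => // e.
  by case/eqP: ij; apply: val_inj; rewrite /= e.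
have sP : (1 < size P)%N.
  rewrite ltnNge; apply/negP => s1; have := cP _ p1.
  by rewrite nth_default // => /eqP; rewrite eq_sym oner_eq0.
have [z /rootP Pz] := closed_rootP _ (negbT (gtn_eqF sP)).
have zp : z ^+ p = 1.
  have := congr1 (fun q : {poly C} => q.[z]) PE.
  rewrite hornerM Pz mulr0 hornerD hornerN hornerXn hornerC.
  by move=> /eqP; rewrite subr_eq0 => /eqP.
have z1 : z != 1.
  apply/eqP => z1; have : P.[z] != 0.
    rewrite z1 horner_sum; under eq_bigr do rewrite hornerXn expr1n.
    by rewrite sumr_const card_ord pnatr_eq0 -lt0n.
  by rewrite Pz eqxx.
have [m mz mp] := prim_order_exists p0 zp; exists z.
have [_ /(_ m mp) /orP[] /eqP me] := primeP pp; last by rewrite -me.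
by move: (prim_expr_order mz); rewrite me expr1 => /eqP; rewrite (negbTE z1).
Qed.

Lemma hyp_orbit_countE n (a v : 'I_n -> Rl) : injective v ->
  hyp_orbit_count a v = #|[set s : 'S_n | \sum_i a i * v (s i) == 0]|.
Proof.
move=> vinj; rewrite /hyp_orbit_count /orbit_seq undup_id; last first.
  rewrite map_inj_uniq ?enum_uniq // => s t /ffunP st; apply/permP => i.
  by have := st i; rewrite !ffunE /permact => /vinj.
rewrite count_map -sum1_count big_enum_cond /= -sum1dep_card.
apply: eq_bigl => s /=; congr (_ == _); apply: eq_bigr => i _.
by rewrite ffunE.
Qed.

(** The form is [S x_(i0) - v_(i0) (x_1 + ... + x_n)]. On the orbit the coordinates sum to [S], so
    it vanishes exactly when [x_(i0) = v_(i0)], that is for the [(n-1)!] permutations fixing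
    [i0]. *)
Lemma hyp_orbit_count_stabilizer n (v : 'I_n -> Rl) : (1 < n)%N -> injective v ->
  \sum_i v i != 0 ->
  exists2 a : 'I_n -> Rl, (exists i, a i != 0) & hyp_orbit_count a v = (n.-1)`!.
Proof.
move=> n1 vinj S0; set S := \sum_i v i in S0.
have [i0 [i1 i10]] : exists i0 i1 : 'I_n, i1 != i0.
  by exists (Ordinal (ltnW n1)), (Ordinal n1).
exists (fun i => (i == i0)%:R * S - v i0).
  have [v0|v0] := eqVneq (v i0) 0.
    by exists i0; rewrite eqxx mul1r v0 subr0.
  by exists i1; rewrite (negbTE i10) mul0r sub0r oppr_eq0.
rewrite hyp_orbit_countE //.
have -> : [set s : 'S_n | \sum_i ((i == i0)%:R * S - v i0) * v (s i) == 0] =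
    [set s | perm_on [set~ i0] s].
  apply/finset.setP => s; rewrite !inE.
  have -> : \sum_i ((i == i0)%:R * S - v i0) * v (s i) = S * (v (s i0) - v i0).
    under eq_bigr do rewrite mulrBl.
    rewrite sumrB (bigD1 i0) //= eqxx mul1r [X in _ + X - _]big1 => [|i ii0]; last first.
      by rewrite (negbTE ii0) !mul0r.
    rewrite addr0 -mulr_sumr mulrBr [v i0 * _]mulrC; congr (_ - _ * _).
    by rewrite /S [RHS](reindex_inj (@perm_inj _ s)).
  rewrite mulf_eq0 (negbTE S0) subr_eq0 (inj_eq vinj) /=.
  apply/idP/idP => [/eqP si|/fintype.subsetP H].
    by apply/fintype.subsetP => i; rewrite !inE; apply: contra_neq => ->.
  by apply/negPn/negP => /H; rewrite !inE eqxx.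
by rewrite cardsE card_perm cardsC1 card_ord.
Qed.

(** The hypotheses on [v] enter here: [f_(p-1)] is minus the sum of the coordinates, hence nonzero,
    and distinct real roots make the critical points of [f] simple. *)
Lemma vanishing_norm_dihedral p (v : 'I_p -> Rl) (C1 : set ('I_p -> Cx))
    (b : 'I_p -> Cx) :
  prime p -> injective v -> \sum_i v i != 0 ->
  irreducible_component (esym_curve v) C1 ->
  (exists i, b i != 0) ->
  vanishing_norm (\prod_i ('X - (Complex (v i) 0)%:P)) b ->
  (stab C1 \isog 'D_(2 * p))%g.
Proof.
move=> pp vinj S0 C1comp b0 Wb; have p0 := prime_gt0 pp.
pose y i : Cx := Complex (v i) 0.
pose f : {poly Cx} := \prod_i ('X - (y i)%:P).
have fy : fiber f 0 y by rewrite /fiber polyC0 subr0.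
have fm : f \is monic by rewrite /f -big_enum /= monic_prod_XsubC.
have sf : size f = p.+1 by rewrite /f -big_enum /= size_prod_XsubC size_enum_ord.
have yinj : injective y by move=> i j; rewrite /y => -[] /vinj.
have yreal i : y i \is Num.real by rewrite complex_real.
have fp1 : f`_p.-1 != 0.
  have := @coefPn_prod_XsubC _ [seq y i | i <- enum 'I_p].
  rewrite big_map [X in - X]big_map !big_enum size_map size_enum_ord -/f => -> //; last by rewrite -lt0n.
  rewrite oppr_eq0; apply: contra S0 => /eqP S0.
  rewrite -(fmorph_eq0 (real_complex Rl)) rmorph_sum; exact/eqP.
have [zeta zP] := prime_prim_root_exists Cx pp.
have simple := simple_crit_real p0 yinj yreal fy.
have p2 : p != 2%N := no_relation_p2 pp zP fm sf fp1 Wb b0.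
have podd : odd p by case: (even_prime pp) => // e; rewrite e in p2.
have p_gt2 : (2 < p)%N by rewrite odd_prime_gt2.
have pE : p = (p.-1./2).*2.+1 by lia.
have q0 : (0 < p.-1./2)%N by lia.
have fm' := fm; have sf' : size f = (p.-1./2).*2.+2 by rewrite sf {1}pE.
have [c [rho [kappa [rho0]]]] := chebyshev_form q0 fm' sf' simple
  (crit_fiber_square pp zP fm sf fp1 Wb b0 simple).
rewrite -pE => fE.
have [s sP] := component_stab pp zP rho0 fE p_gt2
  (fun x => esym_curve_fiber v x p0) C1comp.
have -> : stab C1 = (dih_set pp :^ s^-1)%g.
  apply/finset.setP => t; rewrite inE mem_conjgV.
  by apply/asboolP/idP => /sP.
pose G : {group 'S_p} := Group (dih_group pp).
have isoG : G :^ s^-1 \isog G by rewrite isog_sym conj_isog.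
exact: isog_trans isoG (dih_set_isog pp p_gt2).
Qed.

Theorem theorem5p1 (p : nat) (v : 'I_p -> Rl) (C1 : set ('I_p -> Cx)) :
  prime p ->
  injective v ->
  \sum_i v i != 0 ->
  irreducible_component (esym_curve v) C1 ->
  ~~ (stab C1 \isog 'D_(2 * p))%g ->
  (exists2 a : 'I_p -> Rl, (exists i, a i != 0) & hyp_orbit_count a v = (p.-1)`!) /\
  (forall a : 'I_p -> Rl, (exists i, a i != 0) -> (hyp_orbit_count a v <= (p.-1)`!)%nat).
Proof.
move=> pp vinj S0 C1comp nD; split.
  exact: hyp_orbit_count_stabilizer (prime_gt1 pp) vinj S0.
move=> a [i ai]; pose b i : Cx := Complex (a i) 0; pose y i : Cx := Complex (v i) 0.
have nW : ~ vanishing_norm (\prod_i ('X - (y i)%:P)) b.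
  move=> Wb; case/negP: nD.
  apply: (vanishing_norm_dihedral pp vinj S0 C1comp _ Wb).
  by exists i; apply: contra_neq ai => -[].
have yinj : injective y by move=> j k; rewrite /y => -[] /vinj.
rewrite hyp_orbit_countE //.
have fm : \prod_i ('X - (y i)%:P) \is monic by rewrite -big_enum /= monic_prod_XsubC.
have sf : size (\prod_i ('X - (y i)%:P)) = p.+1.
  by rewrite -big_enum /= size_prod_XsubC size_enum_ord.
have fy : fiber (\prod_i ('X - (y i)%:P)) 0 y by rewrite /fiber polyC0 subr0.
apply: leq_trans (card_relations_bound (prime_gt0 pp) fm sf fy yinj nW).
apply/subset_leq_card/fintype.subsetP => s; rewrite !inE => /eqP as0.
have := congr1 (real_complex Rl) as0; rewrite rmorph_sum rmorph0 /= => /eqP.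
congr (_ == _); apply: eq_bigr => j _; exact: rmorphM.
Qed.
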